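(* Let $p$ be a prime, $n\ge1$, and let $A$ be the pseudo-differential operator on $\Phi'(\mathbb{Q}_p^n)$ with symbol $\mathcal{A}\in\mathcal{E}(\mathbb{Q}_p^n\setminus\{0\})$. If $\mathcal{A}(\xi)\neq0$ for all $\xi\in\mathbb{Q}_p^n\setminus\{0\}$, then for every $g\in\Phi'(\mathbb{Q}_p^n)$ the equation $Af=g$ has the unique solution $$f(x)=F^{-1}\Big[\frac{F[g](\xi)}{\mathcal{A}(\xi)}\Big](x)=(A^{-1}g)(x)\in\Phi'(\mathbb{Q}_p^n).$$
   Context: $\mathcal{D}(\mathbb{Q}_p^n)$ is the space of locally constant compactly supported functions $\mathbb{Q}_p^n\to\mathbb{C}$; $\mathcal{E}(\mathbb{Q}_p^n\setminus\{0\})$ is the space of locally constant functions $\mathbb{Q}_p^n\setminus\{0\}\to\mathbb{C}$. Fourier transform on test functions: $F[\varphi](\xi)=\int_{\mathbb{Q}_p^n}\chi_p(\xi\cdot x)\varphi(x)\,d^nx$, with $\chi_p(\xi\cdot x)=e^{2\pi i\sum_j\{\xi_jx_j\}_p}$, $\{\cdot\}_p$ the $p$-adic fractional part, $d^nx$ normalized Haar measure; $F$ is a linear automorphism of $\mathcal{D}(\mathbb{Q}_p^n)$. $\Psi(\mathbb{Q}_p^n)=\{\psi\in\mathcal{D}(\mathbb{Q}_p^n):\psi(0)=0\}$, $\Phi(\mathbb{Q}_p^n)=F[\Psi(\mathbb{Q}_p^n)]$ (Lizorkin test functions of the second kind); also $F[\Phi]=\Psi$. $\Phi'$ and $\Psi'$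 are their duals (all linear functionals are continuous). For $f\in\Phi'$, $F[f]\in\Psi'$ is defined by $\langle F[f],\psi\rangle=\langle f,F[\psi]\rangle$, $\psi\in\Psi$; similarly $F:\Psi'\to\Phi'$; these are bijections, and $F^{-1}:\Psi'\to\Phi'$ denotes the inverse of $F:\Phi'\to\Psi'$. For $u\in\Psi'$ and $m\in\mathcal{E}(\mathbb{Q}_p^n\setminus\{0\})$, the product $mu\in\Psi'$ is $\langle mu,\psi\rangle=\langle u,m\psi\rangle$ (with $m\psi$ set to $0$ at the origin; elements of $\Psi$ vanish near $0$). The pseudo-differential operator $A$ with symbol $\mathcal{A}$ acts on $\phi\in\Phi$ by $A\phi=F^{-1}[\mathcal{A}\,F[\phi]]\in\Phi$ and on $f\in\Phi'$ by $\langle Af,\phi\rangle=\langle f,A^T\phi\rangle$, $\phi\in\Phi$, where $(A^T\phi)(x)=F^{-1}[\mathcal{A}(-\xi)F[\phi](\xi)](x)$; equivalently $Af=F^{-1}[\mathcal{A}F[f]]$. If $\mathcal{A}$ has no zeros on $\mathbb{Q}_p^n\setminus\{0\}$, then $A^{-1}$ denotes the pseudo-differential operator with symbol $1/\mathcal{A}$. *)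

(* Defs.v *)
From HB Require Import structures.
From mathcomp Require Import all_boot all_order all_algebra.
From mathcomp Require Import ring_quotient.
From mathcomp Require Import all_classical all_reals all_analysis.
From mathcomp Require Import complex.
From mathcomp Require Import zify ring lra.

Set Implicit Arguments.
Unset Strict Implicit.
Unset Printing Implicit Defensive.
Import Order.TTheory GRing.Theory Num.Theory.
Import numFieldNormedType.Exports.
Local Open Scope classical_set_scope.
Local Open Scope ring_scope.
Local Open Scope quotient_scope.


Definition padic_norm (p : nat) (x : rat) : rat :=
  if x == 0 then 0
  else p%:R ^ ((logn p `|denq x|)%:Z - (logn p `|numq x|)%:Z).

Section PadicNormRat.
Variables (p : nat) (pP : prime p).
Local Notation N := (padic_norm p).

Let p0 : (p%:R : rat) != 0.
Proof. by rewrite pnatr_eq0 -lt0n prime_gt0. Qed.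

Let p1 : 1 <= (p%:R : rat).
Proof. by rewrite ler1n prime_gt0. Qed.

Lemma padic_norm0 : N 0 = 0.
Proof. by rewrite /padic_norm eqxx. Qed.

Lemma padic_norm_frac (a b : int) : a != 0 -> b != 0 ->
  N (a%:~R / b%:~R) = p%:R ^ ((logn p `|b|)%:Z - (logn p `|a|)%:Z).
Proof.
move=> a0 b0; rewrite /padic_norm.
have aQ0 : (a%:~R : rat) != 0 by rewrite intr_eq0.
have bQ0 : (b%:~R : rat) != 0 by rewrite intr_eq0.
have x0 : (a%:~R / b%:~R : rat) != 0 by rewrite mulf_neq0 ?invr_eq0.
rewrite (negPf x0); set x := _ / _ in x0 *.
have nx0 : numq x != 0 by rewrite numq_eq0.
have dx0 : denq x != 0 by rewrite denq_eq0.
have E : a * denq x = numq x * b.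
  apply/eqP; rewrite -(eqr_int rat) !rmorphM /=; apply/eqP.
  rewrite numqE.
  by rewrite mulrAC; congr (_ * _); rewrite /x divfK.
have : logn p `|a * denq x| = logn p `|numq x * b| by rewrite E.
rewrite !abszM !lognM ?absz_gt0 // => L; congr (_ ^ _).
lia.
Qed.

Lemma padic_normV_int (a : int) : a != 0 ->
  N a%:~R = p%:R ^ (- (logn p `|a|)%:Z).
Proof.
move=> a0; rewrite -[a%:~R]divr1 -[1]/(1%:~R) padic_norm_frac //.
by rewrite logn1 sub0r.
Qed.

Lemma padic_norm1 : N 1 = 1.
Proof. by rewrite -[X in N X]/(1%:~R) padic_normV_int // logn1. Qed.

Lemma padic_norm_gt0 x : x != 0 -> 0 < N x.
Proof.
by move=> x0; rewrite /padic_norm (negPf x0) exprz_gt0 // ltr0n prime_gt0.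
Qed.

Lemma padic_norm_ge0 x : 0 <= N x.
Proof.
have [->|/padic_norm_gt0/ltW//] := eqVneq x 0.
by rewrite padic_norm0.
Qed.

Lemma padic_norm_eq0 x : (N x == 0) = (x == 0).
Proof.
have [->|x0] := eqVneq x 0; first by rewrite padic_norm0 eqxx.
by rewrite gt_eqF // padic_norm_gt0.
Qed.

Lemma padic_normM x y : N (x * y) = N x * N y.
Proof.
have [->|x0] := eqVneq x 0; first by rewrite mul0r padic_norm0 mul0r.
have [->|y0] := eqVneq y 0; first by rewrite mulr0 padic_norm0 mulr0.
have E (z : rat) : z != 0 -> [/\ numq z != 0 & denq z != 0].
  by move=> z0; rewrite numq_eq0 denq_eq0.
have [nx dx] := E _ x0; have [ny dy] := E _ y0.
rewrite -[x]divq_num_den -[y]divq_num_den mulf_div -!rmorphM /=.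
rewrite !padic_norm_frac ?mulf_neq0 // !abszM !lognM ?absz_gt0 //.
rewrite -expfzDr //; congr (_ ^ _).
by rewrite !PoszD opprD addrACA.
Qed.

Lemma padic_normN x : N (- x) = N x.
Proof.
rewrite -mulN1r padic_normM -[X in N X]/((-1)%:~R) padic_normV_int //.
by rewrite abszN logn1 mul1r.
Qed.

Lemma padic_normV x : N x^-1 = (N x)^-1.
Proof.
have [->|x0] := eqVneq x 0; first by rewrite !(invr0, padic_norm0).
apply: (mulfI (x := N x)); first by rewrite padic_norm_eq0.
by rewrite -padic_normM mulfV // padic_norm1 mulfV // padic_norm_eq0.
Qed.

Let norm_intD (a b : int) :
  N (a%:~R + b%:~R) <= Num.max (N a%:~R) (N b%:~R).
Proof.
have [->|a0] := eqVneq a 0; first by rewrite add0r le_max lexx orbT.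
have [->|b0] := eqVneq b 0; first by rewrite addr0 le_max lexx.
rewrite -rmorphD /=; have [->|ab0] := eqVneq (a + b) 0.
  by rewrite padic_norm0 le_max padic_norm_ge0.
rewrite !padic_normV_int //.
wlog le_ab : a b a0 b0 ab0 / (logn p `|a| <= logn p `|b|)%N.
  move=> H; have [/H|/ltnW/H] := leqP (logn p `|a|) (logn p `|b|); first exact.
  by rewrite maxC (addrC b); apply.
rewrite le_max; apply/orP; left; apply: ler_weXz2l => //.
suff : (logn p `|a| <= logn p `|(a + b)%R|)%N.
  by move=> L; rewrite lerN2 lez_nat.
rewrite -pfactor_dvdn // ?absz_gt0 //.
suff : (Posz (p ^ logn p `|a|)%N %| a + b)%Z by [].
apply: rpredD; rewrite /dvdz; change (p ^ logn p `|a| %| `|a|)%N || change (p ^ logn p `|a| %| `|b|)%N.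
  by rewrite pfactor_dvdn ?absz_gt0.
by rewrite pfactor_dvdn ?absz_gt0.
Qed.

Let norm_fracD (a b d : int) : N (a%:~R / d%:~R + b%:~R / d%:~R) <=
  Num.max (N (a%:~R / d%:~R)) (N (b%:~R / d%:~R)).
Proof.
rewrite -mulrDl !padic_normM -maxr_pMl ?padic_norm_ge0 //.
by rewrite ler_wpM2r ?padic_norm_ge0.
Qed.

Lemma padic_normD x y : N (x + y) <= Num.max (N x) (N y).
Proof.
have dx0 : ((denq x)%:~R : rat) != 0 by rewrite intr_eq0 denq_eq0.
have dy0 : ((denq y)%:~R : rat) != 0 by rewrite intr_eq0 denq_eq0.
have Ex : x = (numq x * denq y)%:~R / (denq x * denq y)%:~R.
  by rewrite !rmorphM /= -mulf_div divff ?mulr1 ?divq_num_den.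
have Ey : y = (denq x * numq y)%:~R / (denq x * denq y)%:~R.
  by rewrite !rmorphM /= -mulf_div divff ?mul1r ?divq_num_den.
have := norm_fracD (numq x * denq y) (denq x * numq y) (denq x * denq y).
by rewrite -Ex -Ey.
Qed.

Lemma padic_normB x y : N (x - y) = N (y - x).
Proof. by rewrite -padic_normN opprB. Qed.

End PadicNormRat.

Section PadicNumbers.
Variables (p : nat) (pP : prime p).
Local Notation N := (padic_norm p).

(* The primality argument is a phantom: it lets the canonical subring structure
   be found from the predicate. *)
Definition padic_cauchy of prime p : {pred nat -> rat} :=
  fun a => `[< forall e : rat, 0 < e -> exists K, forall i j,
    (K <= i)%N -> (K <= j)%N -> N (a i - a j) < e >].

Let cauchyP a : reflect (forall e : rat, 0 < e -> exists K, forall i j,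
  (K <= i)%N -> (K <= j)%N -> N (a i - a j) < e) (a \in padic_cauchy pP).
Proof. exact: asboolP. Qed.

Let cauchy_bounded a : a \in padic_cauchy pP ->
  exists M K, 0 < M /\ forall i, (K <= i)%N -> N (a i) <= M.
Proof.
move=> /cauchyP /(_ 1 ltr01) [K aK]; exists (Num.max 1 (N (a K))), K; split.
  by rewrite lt_max ltr01.
move=> i Ki; rewrite -[a i](subrK (a K)); apply: le_trans (padic_normD pP _ _) _.
rewrite ge_max [X in _ && X]le_max lexx orbT andbT.
by rewrite le_max (ltW (aK _ _ Ki (leqnn K))).
Qed.

Lemma padic_cauchy_subring : subring_closed (padic_cauchy pP).
Proof.
split.
- apply/cauchyP => e e0; exists 0%N => i j _ _.
  by rewrite subrr padic_norm0.
- move=> a b /cauchyP aP /cauchyP bP; apply/cauchyP => e e0.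
  have [K aK] := aP e e0; have [L bL] := bP e e0.
  exists (maxn K L) => i j; rewrite !geq_max => /andP[Ki Li] /andP[Kj Lj].
  have -> : (a - b) i - (a - b) j = (a i - a j) + (b j - b i).
    by rewrite !fctE; ring.
  apply: le_lt_trans (padic_normD pP _ _) _.
  by rewrite gt_max aK // bL.
- move=> a b aP bP; apply/cauchyP => e e0.
  have [A [Ka [A0 aA]]] := cauchy_bounded aP.
  have [B [Kb [B0 bB]]] := cauchy_bounded bP.
  have [K aK] := cauchyP _ aP (e / B) (divr_gt0 e0 B0).
  have [L bL] := cauchyP _ bP (e / A) (divr_gt0 e0 A0).
  exists (maxn (maxn K L) (maxn Ka Kb)) => i j.
  rewrite !geq_max => /andP[/andP[Ki Li] /andP[Kai Kbi]].
  move=> /andP[/andP[Kj Lj] /andP[Kaj Kbj]].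
  have -> : (a * b) i - (a * b) j = a i * (b i - b j) + b j * (a i - a j).
    by rewrite !fctE; ring.
  apply: le_lt_trans (padic_normD pP _ _) _; rewrite !padic_normM // gt_max.
  apply/andP; split.
    apply: le_lt_trans (ler_wpM2r (padic_norm_ge0 pP _) (aA _ Kai)) _.
    by rewrite mulrC -ltr_pdivlMr // bL.
  apply: le_lt_trans (ler_wpM2r (padic_norm_ge0 pP _) (bB _ Kbj)) _.
  by rewrite mulrC -ltr_pdivlMr // aK.
Qed.
HB.instance Definition _ := GRing.isSubringClosed.Build (nat -> rat)
  (padic_cauchy pP) padic_cauchy_subring.

Record cauchy_seq := CauchySeq {
  cauchy_seq_val :> nat -> rat;
  _ : cauchy_seq_val \in padic_cauchy pP }.
HB.instance Definition _ := [isSub for cauchy_seq_val].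
HB.instance Definition _ := [Choice of cauchy_seq by <:].
HB.instance Definition _ := [SubChoice_isSubComNzRing of cauchy_seq by <:].

Definition padic_null : {pred cauchy_seq} :=
  fun a => `[< forall e : rat, 0 < e -> exists K, forall i,
    (K <= i)%N -> N (a i) < e >].

Let nullP (a : cauchy_seq) : reflect (forall e : rat, 0 < e -> exists K, forall i,
    (K <= i)%N -> N (a i) < e) (a \in padic_null).
Proof. exact: asboolP. Qed.

Lemma padic_null_idealr : idealr_closed padic_null.
Proof.
split.
- by apply/nullP => e e0; exists 0%N => i _; rewrite padic_norm0.
- apply/negP => /nullP /(_ 1 ltr01) [K /(_ K (leqnn K))].
  by rewrite padic_norm1 // ltxx.
- move=> a u v /nullP uP /nullP vP; apply/nullP => e e0.
  have [A [Ka [A0 aA]]] := cauchy_bounded (valP a).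
  have [K uK] := uP (e / A) (divr_gt0 e0 A0).
  have [L vL] := vP e e0.
  exists (maxn Ka (maxn K L)) => i; rewrite !geq_max => /and3P[Kai Ki Li].
  apply: le_lt_trans (padic_normD pP _ _) _; rewrite gt_max vL // andbT.
  rewrite padic_normM //.
  apply: le_lt_trans (ler_wpM2r (padic_norm_ge0 pP _) (aA _ Kai)) _.
  by rewrite mulrC -ltr_pdivlMr // uK.
Qed.
HB.instance Definition _ := isIdealr.Build cauchy_seq padic_null
  padic_null_idealr.

(* Q_p as the ring of p-adic Cauchy sequences of rationals modulo the ideal of
   null sequences. *)
Definition padic : Type := {ideal_quot padic_null}.
HB.instance Definition _ := GRing.ComNzRing.on padic.
HB.instance Definition _ := EqQuotient.on padic.

End PadicNumbers.

Section PadicField.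
Variables (p : nat) (pP : prime p).
Local Notation N := (padic_norm p).
Local Notation Qp := (padic pP).
Implicit Types (a b : cauchy_seq pP) (x y z : Qp).

(* |x|_p is the eventual value of |a_i|_p for a Cauchy sequence a representing
   x; it exists unless x = 0, for which the default value 0 is returned. *)
Definition padic_abs x : rat :=
  xget 0 [set r | exists K, forall i, (K <= i)%N -> N (repr x i) = r].

Let nullP a : reflect (forall e : rat, 0 < e -> exists K, forall i,
    (K <= i)%N -> N (a i) < e) (a \in @padic_null p pP).
Proof. exact: asboolP. Qed.

Let cauchyP a (e : rat) : 0 < e -> exists K, forall i j,
  (K <= i)%N -> (K <= j)%N -> N (a i - a j) < e.
Proof. by have /asboolP := valP a; exact. Qed.

Lemma padic_pi_eq0 a : (\pi_Qp a == 0) = (a \in @padic_null p pP).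
Proof. by rewrite -(rmorph0 (\pi_Qp)) -Quotient.idealrBE subr0. Qed.

Let repr_pi_null a : repr (\pi_Qp a) - a \in @padic_null p pP.
Proof. by rewrite Quotient.idealrBE reprK. Qed.

Let norm_eq (u v : rat) : N (u - v) < N v -> N u = N v.
Proof.
move=> uv; apply/eqP; rewrite eq_le; apply/andP; split.
  rewrite -[u in N u](subrK v); apply: le_trans (padic_normD pP _ _) _.
  by rewrite ge_max (ltW uv) lexx.
rewrite leNgt; apply/negP => vu.
have := padic_normD pP u (v - u); rewrite (addrC u) subrK padic_normB //.
by rewrite leNgt gt_max vu uv.
Qed.

Let nonnull_eventually a : a \notin @padic_null p pP ->
  exists c K, 0 < c /\ forall i, (K <= i)%N -> N (a i) = c.
Proof.
move=> na.
have [e [e0 He]] : exists e : rat, 0 < e /\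
    forall K, exists i, (K <= i)%N /\ e <= N (a i).
  apply: contrapT => H; move/negP: na; apply; apply/nullP => e e0.
  apply: contrapT => H'; apply: H; exists e; split => // K.
  apply: contrapT => H''; apply: H'; exists K => i Ki.
  by rewrite ltNge; apply/negP => ?; apply: H''; exists i.
have [K aK] := cauchyP a e0; have [i [Ki ei]] := He K.
exists (N (a i)), K; split; first exact: lt_le_trans ei.
by move=> j Kj; apply: norm_eq; apply: lt_le_trans (aK _ _ Kj Ki) ei.
Qed.

Lemma padic_abs_eventually a : \pi_Qp a != 0 -> 0 < padic_abs (\pi_Qp a) /\
  exists K, forall i, (K <= i)%N -> N (a i) = padic_abs (\pi_Qp a).
Proof.
rewrite padic_pi_eq0 => /nonnull_eventually[c [K [c0 aK]]].
have /nullP/(_ c c0)[L rL] := repr_pi_null a.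
have rc i : (maxn K L <= i)%N -> N (repr (\pi_Qp a) i) = c.
  rewrite geq_max => /andP[Ki Li]; rewrite -(aK _ Ki); apply: norm_eq.
  by rewrite (aK _ Ki); exact: rL.
have -> : padic_abs (\pi_Qp a) = c.
  rewrite /padic_abs; case: xgetP => [r _ [M rM]|/(_ c)]; last first.
    by case; exists (maxn K L).
  by rewrite -(rM (maxn M (maxn K L)) (leq_maxl _ _)) rc // leq_maxr.
by split => //; exists K.
Qed.

Lemma padic_abs0 : padic_abs 0 = 0.
Proof.
rewrite /padic_abs; case: xgetP => // r _ [K rK].
have : repr (0 : Qp) \in @padic_null p pP by rewrite -padic_pi_eq0 reprK.
move=> r0; apply/eqP; rewrite eq_le; apply/andP; split; last first.
  by rewrite -(rK K (leqnn K)) padic_norm_ge0.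
rewrite leNgt; apply/negP => /(nullP _ r0) [L rL].
have := rL (maxn K L) (leq_maxr _ _).
by rewrite rK ?leq_maxl // ltxx.
Qed.

Lemma padic_abs_gt0 x : x != 0 -> 0 < padic_abs x.
Proof. by rewrite -[x]reprK => /padic_abs_eventually[]. Qed.

Lemma padic_abs_ge0 x : 0 <= padic_abs x.
Proof. by have [->|/padic_abs_gt0/ltW//] := eqVneq x 0; rewrite padic_abs0. Qed.

Lemma padic_abs_eq0 x : (padic_abs x == 0) = (x == 0).
Proof.
have [->|x0] := eqVneq x 0; first by rewrite padic_abs0 eqxx.
by rewrite gt_eqF // padic_abs_gt0.
Qed.

Let padic_inv x : Qp := xget 0 [set y | y * x = 1].

Let padic_mulVf x : x != 0 -> padic_inv x * x = 1.
Proof.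
move=> x0; apply: (@xgetPex _ 0 [set y | y * x = 1]).
move: x0; rewrite -[x]reprK; move: (repr x) => {x} a.
rewrite padic_pi_eq0 => /nonnull_eventually[c [K [c0 aK]]].
have a0 i : (K <= i)%N -> a i != 0.
  by move=> /aK ac; rewrite -(padic_norm_eq0 pP) ac gt_eqF.
have aV : (fun i => (a i)^-1) \in padic_cauchy pP.
  apply/asboolP => e e0.
  have [L aL] := cauchyP a (mulr_gt0 e0 (mulr_gt0 c0 c0)).
  exists (maxn K L) => i j; rewrite !geq_max => /andP[Ki Li] /andP[Kj Lj].
  have -> : (a i)^-1 - (a j)^-1 = (a j - a i) / (a i * a j).
    by field; rewrite !a0.
  rewrite padic_normM // padic_normV // padic_normM // !aK //.
  by rewrite ltr_pdivrMr ?mulr_gt0 // aL.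
exists (\pi_Qp (CauchySeq aV)); apply/eqP.
rewrite -rmorphM -(rmorph1 (\pi_Qp)) -subr_eq0 -rmorphB padic_pi_eq0.
apply/nullP => e e0; exists K => i Ki.
change (N ((a i)^-1 * a i - 1) < e).
by rewrite mulVf ?a0 // subrr padic_norm0.
Qed.

Let padic_inv0 : padic_inv 0 = 0.
Proof.
rewrite /padic_inv; case: xgetP => // y _ /eqP.
by rewrite /= mulr0 eq_sym oner_eq0.
Qed.

HB.instance Definition _ :=
  GRing.ComNzRing_isField.Build Qp padic_mulVf padic_inv0.

Lemma padic_absM x y : padic_abs (x * y) = padic_abs x * padic_abs y.
Proof.
have [->|x0] := eqVneq x 0; first by rewrite !(mul0r, padic_abs0).
have [->|y0] := eqVneq y 0; first by rewrite !(mulr0, padic_abs0).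
have : x * y != 0 by rewrite mulf_neq0.
move: x0 y0; rewrite -[x]reprK -[y]reprK; move: (repr x) (repr y) => a b.
move=> /padic_abs_eventually[_ [K aK]] /padic_abs_eventually[_ [L bL]].
rewrite -rmorphM => /padic_abs_eventually[_ [M abM]].
pose i := maxn K (maxn L M).
rewrite -(abM i) -?(aK i) -?(bL i) -?padic_normM // /i; lia.
Qed.

Lemma padic_absD x y : padic_abs (x + y) <= Num.max (padic_abs x) (padic_abs y).
Proof.
have [->|x0] := eqVneq x 0; first by rewrite add0r le_max lexx orbT.
have [->|y0] := eqVneq y 0; first by rewrite addr0 le_max lexx.
have [->|] := eqVneq (x + y) 0.
  by rewrite padic_abs0 le_max padic_abs_ge0.
move: x0 y0; rewrite -[x]reprK -[y]reprK; move: (repr x) (repr y) => a b.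
move=> /padic_abs_eventually[_ [K aK]] /padic_abs_eventually[_ [L bL]].
rewrite -rmorphD => /padic_abs_eventually[_ [M abM]].
pose i := maxn K (maxn L M).
have [iK iL iM] : [/\ K <= i, L <= i & M <= i]%N by rewrite /i; split; lia.
by rewrite -(abM i) // -(aK i) // -(bL i) // padic_normD.
Qed.

Lemma padic_absN x : padic_abs (- x) = padic_abs x.
Proof.
have [->|x0] := eqVneq x 0; first by rewrite oppr0.
have : - x != 0 by rewrite oppr_eq0.
move: x0; rewrite -[x]reprK; move: (repr x) => a.
move=> /padic_abs_eventually[_ [K aK]]; rewrite -rmorphN => /padic_abs_eventually[_ [M nM]].
by rewrite -(nM (maxn K M)) ?leq_maxr // -(aK (maxn K M)) ?leq_maxl ?padic_normN.
Qed.

Let padic_abs_int (m : int) : padic_abs m%:~R = N m%:~R.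
Proof.
have [->|m0] := eqVneq m 0; first by rewrite padic_abs0 padic_norm0.
have mi i : (m%:~R : cauchy_seq pP) i = m%:~R.
  have -> : (m%:~R : cauchy_seq pP) i = (m%:~R : nat -> rat) i.
    by rewrite -[LHS]/(val (m%:~R : cauchy_seq pP) i) rmorph_int.
  have E k : ((k%:R : nat -> rat) i) = k%:R by elim: k => // k IH; rewrite !mulrS -IH.
  case: m {m0} => k; first exact: E.
  by rewrite !NegzE !rmorphN /= -[RHS]/(- k.+1%:R) -(E k.+1).
have mN0 : N m%:~R != 0 by rewrite padic_norm_eq0 // intr_eq0.
have : \pi_Qp (m%:~R : cauchy_seq pP) != 0.
  rewrite padic_pi_eq0; apply/negP => /nullP /(_ (N m%:~R)) [].
    by rewrite lt_def mN0 padic_norm_ge0.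
  by move=> K /(_ K (leqnn K)); rewrite mi ltxx.
by move=> /padic_abs_eventually[_ [K /(_ K (leqnn K))]]; rewrite mi rmorph_int => ->.
Qed.

Lemma padic_abs_ratr (r : rat) : padic_abs (ratr r) = N r.
Proof.
have d0 : ((denq r)%:~R : Qp) != 0.
  rewrite -padic_abs_eq0 padic_abs_int padic_norm_eq0 // intr_eq0.
  exact: denq_neq0.
apply: (mulIf (x := padic_abs (denq r)%:~R)); first by rewrite padic_abs_eq0.
rewrite -padic_absM /ratr divfK // !padic_abs_int -padic_normM //.
by rewrite numqE.
Qed.

(* The metric takes rational values, since |x|_p is 0 or a power of p. *)
Let padic_distxx x : padic_abs (x - x) = 0.
Proof. by rewrite subrr padic_abs0. Qed.

Let padic_dist_eq0 x y : padic_abs (x - y) = 0 -> x = y.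
Proof. by move/eqP; rewrite padic_abs_eq0 subr_eq0 => /eqP. Qed.

Lemma padic_distC x y : padic_abs (x - y) = padic_abs (y - x).
Proof. by rewrite -padic_absN opprB. Qed.

Let padic_dist_triangle y x z :
  padic_abs (x - z) <= padic_abs (x - y) + padic_abs (y - z).
Proof.
have -> : x - z = (x - y) + (y - z) by rewrite addrA subrK.
apply: le_trans (padic_absD _ _) _.
by rewrite ge_max lerDl lerDr !padic_abs_ge0.
Qed.

HB.instance Definition _ := isMetric.Build rat Qp
  padic_distxx padic_dist_eq0 padic_distC padic_dist_triangle.
HB.instance Definition _ := isPointed.Build Qp 0.

End PadicField.

Definition locally_constant_on (T : topologicalType) (Y : Type) (D : set T)
    (f : T -> Y) := forall x, D x -> \forall y \near x, f y = f x.

Section Fourier.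
Variables (R : realType) (p : nat) (pP : prime p) (n : nat).
Local Notation Qp := (padic pP).
Local Notation V := 'rV[Qp]_n.
Local Notation C := R[i].

(* {x}_p is the unique element of Z[1/p] in [0, 1[ congruent to x modulo the
   p-adic integers. *)
Definition padic_frac (x : Qp) : rat :=
  xget 0 [set r | [/\ 0 <= r < 1, exists k, p%:R ^+ k * r \is a Num.int &
                      padic_abs (x - ratr r) <= 1]].

(* chi_p(xi . x) = exp(2 pi i sum_j {xi_j x_j}_p). *)
Definition padic_char (xi x : V) : C :=
  let t := 2 * pi * ratr (\sum_j padic_frac (xi 0 j * x 0 j)) in
  (cos t +i* sin t)%C.

Definition padic_borel := g_sigma_algebraType (@open V).

(* Translation invariant Borel measures giving mass 1 to Z_p^n: this is exactly
   the normalized Haar measure d^n x. *)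
Record haar := Haar {
  haar_measure :> {measure set padic_borel -> \bar R};
  haar_translate : forall (a : V) (A : set padic_borel), measurable A ->
    haar_measure [set (a + x : V) | x in A] = haar_measure A;
  haar_integers :
    haar_measure [set x : V | forall j, padic_abs (x 0 j) <= 1] = 1%E }.

Definition complex_integral (mu : haar) (h : V -> C) : C :=
  (\int[mu]_x complex.Re (h x) +i* \int[mu]_x complex.Im (h x))%C.

Definition fourier (mu : haar) (phi : V -> C) (xi : V) : C :=
  complex_integral mu (fun x => padic_char xi x * phi x).

(* The test functions, i.e. the elements of D(Q_p^n). *)
Definition is_test (phi : V -> C) :=
  locally_constant_on setT phi /\ compact (closure [set x | phi x != 0]).

(* Psi(Q_p^n), the Lizorkin test functions of the first kind. *)
Definition in_lizorkin1 : {pred V -> C} :=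
  fun psi => `[< is_test psi /\ psi 0 = 0 >].

(* Phi(Q_p^n) = F[Psi(Q_p^n)], the Lizorkin test functions of the second kind. *)
Definition in_lizorkin2 (mu : haar) : {pred V -> C} :=
  fun phi => `[< exists2 psi, psi \in in_lizorkin1 & phi = fourier mu psi >].

(* A symbol is a locally constant function on Q_p^n \ {0}; it is represented
   by a function whose value at 0 is irrelevant. *)
Record symbol := Symbol {
  symbol_fun :> V -> C;
  symbol_locally_constant : locally_constant_on [set~ (0 : V)] symbol_fun }.

Definition mul_symbol (m : V -> C) (psi : V -> C) (xi : V) : C :=
  if xi == 0 then 0 else m xi * psi xi.

Lemma test_linear (a : R[i]) f g : is_test f -> is_test g ->
  is_test (a *: f + g).
Proof.
move=> [fl fK] [gl gK]; split.
  move=> x _; near=> y.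
  have fy : f y = f x by near: y; exact: fl.
  have gy : g y = g x by near: y; exact: gl.
  by rewrite !fctE fy gy.
apply: (@subclosed_compact _ _ (closure [set x | f x != 0] `|`
                                closure [set x | g x != 0])).
- exact: closed_closure.
- exact: compactU.
- rewrite -closureU; apply: closureS => x /=; apply: contraNP => /not_orP[].
  move=> /negP/negPn/eqP fx /negP/negPn/eqP gx.
  by rewrite !fctE fx gx scaler0 addr0.
Unshelve. all: by end_near.
Qed.

Lemma lizorkin1_submod : submod_closed in_lizorkin1.
Proof.
split.
  apply/asboolP; split => //; split; first by move=> x _; near=> y.
  rewrite [X in closure X](_ : _ = set0) ?closure0; first exact: compact0.
  by rewrite -subset0 => x /=; rewrite eqxx.
move=> a f g /asboolP[ft f0] /asboolP[gt g0]; apply/asboolP; split.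
  exact: test_linear.
by rewrite !fctE f0 g0 scaler0 addr0.
Unshelve. all: by end_near.
Qed.
HB.instance Definition _ := GRing.isSubmodClosed.Build R[i] (V -> C)
  in_lizorkin1 lizorkin1_submod.

Lemma test_mul f g : locally_constant_on setT f -> is_test g ->
  is_test (fun x => f x * g x).
Proof.
move=> fl [gl gK]; split.
  move=> x _; near=> y.
  have fy : f y = f x by near: y; exact: fl.
  have gy : g y = g x by near: y; exact: gl.
  by rewrite fy gy.
apply: subclosed_compact gK _; first exact: closed_closure.
by apply: closureS => x /=; apply: contraNN => /eqP->; rewrite mulr0.
Unshelve. all: by end_near.
Qed.

Lemma mul_symbol_lizorkin1 (A : symbol) psi : psi \in in_lizorkin1 ->
  mul_symbol A psi \in in_lizorkin1.
Proof.
move=> /asboolP[[pl pK] p0]; apply/asboolP; split; last first.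
  by rewrite /mul_symbol eqxx.
have E : mul_symbol A psi = fun x => A x * psi x.
  apply/funext => x; rewrite /mul_symbol.
  by case: eqVneq => // ->; rewrite p0 mulr0.
rewrite E; split.
  move=> x _; have [->|/eqP x0] := eqVneq x 0.
    near=> y; suff -> : psi y = psi 0 by rewrite p0 !mulr0.
    by near: y; exact: pl.
  near=> y.
  have -> : A y = A x by near: y; exact: symbol_locally_constant.
  by congr (_ * _); near: y; exact: pl.
apply: subclosed_compact pK _; first exact: closed_closure.
by apply: closureS => x /=; apply: contraNN => /eqP->; rewrite mulr0.
Unshelve. all: by end_near.
Qed.

Lemma padic_frac_coset (x y : Qp) : padic_abs (x - y) <= 1 ->
  padic_frac x = padic_frac y.
Proof.
move=> xy; congr (xget 0 _); apply/seteqP; split => r [r1 rp xr]; split => //.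
  have -> : y - ratr r = (y - x) + (x - ratr r) by rewrite addrA subrK.
  by apply: le_trans (padic_absD _ _) _; rewrite ge_max padic_distC xy.
have -> : x - ratr r = (x - y) + (y - ratr r) by rewrite addrA subrK.
by apply: le_trans (padic_absD _ _) _; rewrite ge_max xy.
Qed.

Lemma padic_char_locally_constant (xi : V) :
  locally_constant_on setT (padic_char xi).
Proof.
move=> x _.
have H : nbhs x [set y : V | forall j, padic_abs (xi 0 j * (y 0 j - x 0 j)) <= 1].
  exists (fun _ j => [set z | padic_abs (xi 0 j * (z - x 0 j)) <= 1]).
    move=> i j; rewrite (ord1 i).
    have [->|xi0] := eqVneq (xi 0 j) 0.
      by near=> z; rewrite /= mul0r padic_abs0.
    have e0 : 0 < (padic_abs (xi 0 j))^-1 by rewrite invr_gt0 padic_abs_gt0.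
    apply: filterS (nbhsx_ballx (x 0 j) _ e0) => z /=; rewrite ballEmdist /=.
    move=> xz; rewrite padic_absM -ler_pdivlMl ?padic_abs_gt0 // mulr1.
    by rewrite padic_distC ltW.
  by move=> y yP j; apply: yP.
apply: filterS H => y yx; rewrite /padic_char.
suff -> : \sum_j padic_frac (xi 0 j * y 0 j) = \sum_j padic_frac (xi 0 j * x 0 j).
  by [].
by apply: eq_bigr => j _; apply: padic_frac_coset; rewrite -mulrBr.
Unshelve. all: by end_near.
Qed.

End Fourier.

Section FourierTheory.
Variables (R : realType) (p : nat) (pP : prime p) (n : nat).
Local Notation Qp := (padic pP).
Local Notation V := 'rV[Qp]_n.
Local Notation C := R[i].
Variable mu : haar R pP n.

Let Zpn : set V := [set x | forall j, padic_abs (x 0 j) <= 1].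

Let ball1_Zpn (a x : V) : ball a 1 x -> [set (a + y : V) | y in Zpn] x.
Proof.
move=> [_ ax]; exists (x - a); last by rewrite addrC subrK.
move=> j; have := ax 0 j; rewrite ballEmdist /= => axj.
by rewrite !mxE padic_distC; exact: ltW.
Qed.

Lemma Zpn_open (a : V) : open [set (a + y : V) | y in Zpn].
Proof.
rewrite openE => x [y yZ <-]; apply: filterS (nbhsx_ballx (a + y) 1 ltr01) => z.
move=> /ball1_Zpn[w wZ <-]; exists (y + w); last by rewrite addrA.
move=> j; rewrite mxE; apply: le_trans (padic_absD _ _) _.
by rewrite ge_max yZ wZ.
Qed.

Lemma open_measurable_borel (A : set V) :
  open A -> measurable (A : set (padic_borel pP n)).
Proof. by move=> oA; exact: sub_sigma_algebra. Qed.

Lemma closed_measurable_borel (A : set V) :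
  closed A -> measurable (A : set (padic_borel pP n)).
Proof.
move=> cA; rewrite -[A]setCK; apply: measurableC.
by apply: open_measurable_borel; exact: closed_openC.
Qed.

Lemma mu_Zpn (a : V) : mu [set (a + y : V) | y in Zpn] = 1%E.
Proof.
rewrite haar_translate; first exact: haar_integers.
have -> : Zpn = [set (0 + y : V) | y in Zpn].
  apply/seteqP; split => x; first by exists x => //; rewrite add0r.
  by case=> y yZ <-; rewrite add0r.
by apply: open_measurable_borel; exact: Zpn_open.
Qed.

Lemma haar_compact (K : set V) : compact K -> closed K -> (mu K < +oo)%E.
Proof.
rewrite compact_cover => Kco Kcl.
have [|x Kx|D _ KD] := Kco V setT (fun a => [set (a + y : V) | y in Zpn]).
- by move=> a _; exact: Zpn_open.
- exists x => //; exists 0; last by rewrite addr0.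
  by move=> j; rewrite mxE padic_abs0.
have [U [mU KU Ufin]] : exists U : set V,
    [/\ measurable (U : set (padic_borel pP n)), K `<=` U & (mu U < +oo)%E].
  have : K `<=` cover [set` finmap.enum_fset D]
    (fun a => [set (a + y : V) | y in Zpn]) by [].
  elim: (finmap.enum_fset D) K {Kco Kcl KD} => [|a s IH] K KD.
    exists set0; split => //; last by rewrite measure0.
    by move=> x /KD[].
  have [|U [mU KU Ufin]] := IH (K `\` [set (a + y : V) | y in Zpn]).
    move=> x [/KD[b /=]]; rewrite inE => /orP[/eqP-> //|bs bx _].
    by exists b.
  exists ([set (a + y : V) | y in Zpn] `|` U); split.
  - by apply: measurableU => //; apply: open_measurable_borel; exact: Zpn_open.
  - move=> x Kx; have [?|?] := pselect ([set (a + y : V) | y in Zpn] x).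
      by left.
    by right; apply: KU.
  - have mZ : measurable ([set (a + y : V) | y in Zpn] : set (padic_borel pP n)).
      by apply: open_measurable_borel; exact: Zpn_open.
    apply: le_lt_trans (measureU2 _ mZ mU) _.
    have fZ : (mu [set ((a + y)%R : V) | y in Zpn] < +oo)%E by rewrite mu_Zpn ltry.
    exact: lte_add_pinfty fZ Ufin.
apply: le_lt_trans Ufin; apply: le_measure => //; rewrite inE //.
exact: closed_measurable_borel.
Qed.

Lemma integrable_locally_constant (g : V -> R) : locally_constant_on setT g ->
  compact (closure [set x | g x != 0]) ->
  mu.-integrable setT (EFin \o g).
Proof.
set K := closure _ => gl gK.
have mK : measurable (K : set (padic_borel pP n)).
  by apply: closed_measurable_borel; exact: closed_closure.
have mg : measurable_fun setT (g : padic_borel pP n -> R).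
  move=> _ Y mY; rewrite setTI; apply: open_measurable_borel.
  rewrite openE => x /= gY; rewrite /interior; near=> y.
  suff gyx : g y = g x by rewrite /= gyx.
  by near: y; exact: gl.
have -> : EFin \o g = (EFin \o g) \_ K.
  apply/funext => x; rewrite /patch; case: ifPn => // /negP xK.
  rewrite /=; congr EFin; apply/eqP/negPn/negP => gx; apply: xK.
  by rewrite inE; exact: subset_closure.
apply/(integrable_mkcond _ mK); apply: measurable_bounded_integrable => //.
- by apply: haar_compact => //; exact: closed_closure.
- exact: measurable_funTS.
- have /compact_bounded : compact (g @` K).
    apply: continuous_compact => //; apply: continuous_subspaceT => x.
    by move=> P Pg; apply: filterS (gl x I) => y /= ->; exact: nbhs_singleton.
  move=> [M [Mr HM]]; exists M; split => // N MN x Kx.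
  by apply: (HM N MN); exists x.
Unshelve. all: by end_near.
Qed.

Let integrable_test (l : C -> R) h : l 0 = 0 -> is_test h ->
  mu.-integrable setT (EFin \o (fun x => l (h x))).
Proof.
move=> l0 [hl hK]; apply: integrable_locally_constant.
  by move=> x _; apply: filterS (hl x I) => y ->.
apply: subclosed_compact hK _; first exact: closed_closure.
by apply: closureS => x /=; apply: contraNN => /eqP->; rewrite l0.
Qed.

Lemma complex_integral_test_linear (a : C) h k : is_test h -> is_test k ->
  complex_integral mu (fun x => a * h x + k x) =
  a * complex_integral mu h + complex_integral mu k.
Proof.
move=> ht kt; case: a => ar ai; rewrite /complex_integral.
have hR := integrable_test (l := @complex.Re R) (erefl _) ht.
have hI := integrable_test (l := @complex.Im R) (erefl _) ht.
have kR := integrable_test (l := @complex.Re R) (erefl _) kt.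
have kI := integrable_test (l := @complex.Im R) (erefl _) kt.
have E (u v : V -> R) (c d : R) :
    mu.-integrable setT (EFin \o u) -> mu.-integrable setT (EFin \o v) ->
    \int[mu]_x (c * u x + d * v x) = c * (\int[mu]_x u x) + d * (\int[mu]_x v x)
    /\ mu.-integrable setT (EFin \o (fun x => c * u x + d * v x)).
  move=> iu iv.
  have iu' : mu.-integrable setT (EFin \o (fun x => c * u x)).
    exact: (integrableZl measurableT c iu).
  have iv' : mu.-integrable setT (EFin \o (fun x => d * v x)).
    exact: (integrableZl measurableT d iv).
  split; last exact: (integrableD measurableT iu' iv').
  by rewrite RintegralD // !RintegralZl.
have [E1 i1] := E _ _ ar (- ai) hR hI.
have [E2 i2] := E _ _ ar ai hI hR.
have [E3 _] := E _ _ 1 1 i1 kR.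
have [E4 _] := E _ _ 1 1 i2 kI.
rewrite (_ : (fun x => complex.Re _) = (fun x =>
    1 * (ar * complex.Re (h x) + - ai * complex.Im (h x)) +
    1 * complex.Re (k x))); last first.
  by apply/funext => x; case: (h x) (k x) => [? ?] [? ?] /=; ring.
rewrite (_ : (fun x => complex.Im _) = (fun x =>
    1 * (ar * complex.Im (h x) + ai * complex.Re (h x)) +
    1 * complex.Im (k x))); last first.
  by apply/funext => x; case: (h x) (k x) => [? ?] [? ?] /=; ring.
rewrite E3 E4 E1 E2 /=; apply/eqP; rewrite eq_complex /=.
by apply/andP; split; apply/eqP; ring.
Qed.

Lemma fourier_test_linear (a : C) f g : is_test f -> is_test g ->
  fourier mu (a *: f + g) = a *: fourier mu f + fourier mu g.
Proof.
move=> ft gt; apply/funext => xi; rewrite !fctE /fourier.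
rewrite -[RHS]complex_integral_test_linear.
- by congr complex_integral; apply/funext => x; rewrite -[a *: f x]/(a * f x) mulrDr mulrCA.
- by apply: test_mul => //; exact: padic_char_locally_constant.
- by apply: test_mul => //; exact: padic_char_locally_constant.
Qed.

End FourierTheory.

Section PseudoDifferential.
Variables (R : realType) (p : nat) (pP : prime p) (n : nat).
Local Notation V := 'rV[padic pP]_n.
Local Notation C := R[i].

Lemma lizorkin2_submod (mu : haar R pP n) : submod_closed (in_lizorkin2 mu).
Proof.
have lin a f g : f \in @in_lizorkin1 R p pP n -> g \in @in_lizorkin1 R p pP n ->
    fourier mu (a *: f + g) = a *: fourier mu f + fourier mu g.
  by move=> /asboolP[ft _] /asboolP[gt _]; exact: fourier_test_linear.
have P0 : (0 : V -> C) \in @in_lizorkin1 R p pP n by exact: rpred0.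
split.
  apply/asboolP; exists 0 => //.
  by have := lin (-1) 0 0 P0 P0; rewrite !scaleN1r !addNr.
move=> a f g /asboolP[f' f'P ->] /asboolP[g' g'P ->]; apply/asboolP.
exists (a *: f' + g'); last by rewrite lin.
by rewrite rpredD // rpredZ.
Qed.
HB.instance Definition _ (mu : haar R pP n) :=
  GRing.isSubmodClosed.Build R[i] (V -> C) (in_lizorkin2 mu)
    (lizorkin2_submod mu).

Record lizorkin1 := Lizorkin1 {
  lizorkin1_fun :> V -> C; _ : lizorkin1_fun \in @in_lizorkin1 R p pP n }.
HB.instance Definition _ := [isSub for lizorkin1_fun].
HB.instance Definition _ := [Choice of lizorkin1 by <:].
HB.instance Definition _ := [SubChoice_isSubLmodule of lizorkin1 by <:].

Variable mu : haar R pP n.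

Record lizorkin2 := Lizorkin2 {
  lizorkin2_fun :> V -> C; _ : lizorkin2_fun \in in_lizorkin2 mu }.
HB.instance Definition _ := [isSub for lizorkin2_fun].
HB.instance Definition _ := [Choice of lizorkin2 by <:].
HB.instance Definition _ := [SubChoice_isSubLmodule of lizorkin2 by <:].

(* Psi' and Phi': every linear functional is continuous for the topology used on
   these spaces, so these are the algebraic duals. *)
Definition dual1 := {linear lizorkin1 -> C}.
Definition dual2 := {linear lizorkin2 -> C}.

Lemma fourier1_subproof (psi : lizorkin1) : fourier mu psi \in in_lizorkin2 mu.
Proof. by apply/asboolP; exists psi => //; exact: (valP psi). Qed.

Definition fourier1 (psi : lizorkin1) : lizorkin2 :=
  Lizorkin2 (fourier1_subproof psi).

Lemma fourier1_linear : linear fourier1.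
Proof.
move=> a f g; apply: val_inj => /=.
have /asboolP[ft _] := valP f; have /asboolP[gt _] := valP g.
exact: fourier_test_linear.
Qed.
HB.instance Definition _ := GRing.isLinear.Build C lizorkin1 lizorkin2 _
  fourier1 fourier1_linear.

(* F^-1 : Psi -> Phi, the inverse of the bijection F : Phi -> Psi; outside Psi
   the value is irrelevant. *)
Definition fourier_inv (psi : V -> C) : lizorkin2 :=
  xget 0 [set phi : lizorkin2 | fourier mu phi = psi].

Definition dual_fourier (f : dual2) : dual1 := f \o fourier1.

(* F^-1 : Psi' -> Phi', the inverse of the bijection F : Phi' -> Psi'. *)
Definition dual_fourier_inv (u : dual1) : dual2 :=
  get [set f : dual2 | dual_fourier f = u].

Definition mul_symbol1 (A : symbol R pP n) (psi : lizorkin1) : lizorkin1 :=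
  Lizorkin1 (mul_symbol_lizorkin1 A (valP psi)).

Lemma mul_symbol1_linear (A : symbol R pP n) : linear (mul_symbol1 A).
Proof.
move=> a f g; apply: val_inj; apply/funext => x /=.
rewrite !fctE /mul_symbol; case: ifP => _; first by rewrite scaler0 addr0.
by rewrite mulrDr -[a *: f x]/(a * f x) mulrCA.
Qed.
HB.instance Definition _ (A : symbol R pP n) :=
  GRing.isLinear.Build C lizorkin1 lizorkin1 _ (mul_symbol1 A)
    (mul_symbol1_linear A).

Definition dual_mul (A : symbol R pP n) (u : dual1) : dual1 :=
  u \o mul_symbol1 A.

Lemma symbol_inv_subproof (A : symbol R pP n) :
  locally_constant_on [set~ (0 : V)] (fun xi => (A xi)^-1).
Proof.
by move=> x x0; apply: filterS (symbol_locally_constant A x0) => y ->.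
Qed.

Definition symbol_inv (A : symbol R pP n) : symbol R pP n :=
  Symbol (@symbol_inv_subproof A).

Definition pdo_transpose (A : symbol R pP n) (phi : lizorkin2) : lizorkin2 :=
  fourier_inv (mul_symbol (fun xi => A (- xi)) (fourier mu phi)).

Definition pdo (A : symbol R pP n) (f : dual2) (phi : lizorkin2) : C :=
  f (pdo_transpose A phi).

End PseudoDifferential.

(* Main.v *)
(* Everything rests on Fourier inversion on D(Q_p^n): F[F[psi]](x) = psi(-x).
   A test function is a finite combination of indicators of cosets a + p^k Z_p^n
   for every large k. Since a nontrivial additive character has integral 0 over a
   subgroup, F maps the indicator of a + p^k Z_p^n to a character times a multiple
   of the indicator of p^-k Z_p^n, and F o F maps it to a multiple, depending only
   on k, of its reflection. Hence F : Psi -> Phi is bijective and conjugates A^T to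
   the multiplication by the symbol; dually, F turns A into the multiplication by
   the symbol on Psi', which is inverted by the multiplication by its inverse. *)
Require Import Defs.
From HB Require Import structures.
From mathcomp Require Import all_boot all_order all_algebra.
From mathcomp Require Import all_classical all_reals all_analysis.
From mathcomp Require Import complex.
From mathcomp Require Import zify ring lra.
Set Implicit Arguments.
Unset Strict Implicit.
Unset Printing Implicit Defensive.
Import Order.TTheory GRing.Theory Num.Theory.
Import numFieldNormedType.Exports.
Local Open Scope ring_scope.

(** * Fractional parts: existence, uniqueness, and additivity modulo Z *)

Section PadicFractionalPart.
Local Open Scope quotient_scope.
Variables (p : nat) (pP : prime p).
Local Notation N := (padic_norm p).
Local Notation Qp := (padic pP).

Lemma natr_prime_neq0 (F : numDomainType) : (p%:R : F) != 0.
Proof. by rewrite pnatr_eq0 -lt0n prime_gt0. Qed.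

Lemma padic_norm_prime : N p%:R = p%:R^-1.
Proof.
rewrite -[p%:R]/((p : int)%:~R) (padic_normV_int pP); last by move: (prime_gt0 pP); lia.
by rewrite absz_nat logn_prime // eqxx exprN1.
Qed.

Lemma padic_normX x m : N (x ^+ m) = N x ^+ m.
Proof.
by elim: m => [|m IH]; rewrite ?expr0 ?padic_norm1 // !exprS padic_normM // IH.
Qed.

Lemma padic_norm_int_le1 (a : int) : N a%:~R <= 1.
Proof.
have [->|a0] := eqVneq a 0; first by rewrite padic_norm0.
rewrite padic_normV_int // -exprnN invf_le1 ?exprn_gt0 ?ltr0n ?prime_gt0 //.
by rewrite exprn_ege1 // ler1n prime_gt0.
Qed.

Lemma padic_norm_coprime (b : int) : coprime p `|b|%N -> N b%:~R = 1.
Proof.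
move=> pb; have [b0|b0] := eqVneq b 0.
  by move: pb (prime_gt1 pP); rewrite b0 absz0 /coprime gcdn0 => /eqP->.
rewrite padic_normV_int // lognE absz_gt0 b0 pP /=.
by move: pb; rewrite prime_coprime // => /negPf->.
Qed.

(** Membership in Z[1/p], in the form used by [padic_frac]. *)
Definition padic_denom (r : rat) := exists k, p%:R ^+ k * r \is a Num.int.

Lemma padic_denom_exp k r l : (k <= l)%N ->
  (p%:R : rat) ^+ k * r \is a Num.int -> (p%:R : rat) ^+ l * r \is a Num.int.
Proof.
move=> /subnK <- H; rewrite exprD -mulrA rpredM //.
by rewrite -natrX; exact: intr_nat.
Qed.

Lemma padic_denomD r s : padic_denom r -> padic_denom s -> padic_denom (r + s).
Proof.
move=> [k kr] [l ls]; exists (maxn k l); rewrite mulrDr rpredD //.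
  exact: padic_denom_exp (leq_maxl _ _) kr.
exact: padic_denom_exp (leq_maxr _ _) ls.
Qed.

Lemma padic_denomN r : padic_denom r -> padic_denom (- r).
Proof. by move=> [k kr]; exists k; rewrite mulrN rpredN. Qed.

(** This is Z[1/p] ∩ Z_p = Z: if p^k r = a is an integer and |r|_p <= 1, then |a|_p <= p^-k, so p^k
    divides a. *)
Lemma padic_denom_int r : padic_denom r -> N r <= 1 -> r \is a Num.int.
Proof.
move=> [k /intrP [a ra]] r1.
have pk0 : (p%:R : rat) ^+ k != 0 by rewrite expf_neq0 // natr_prime_neq0.
have [a0|a0] := eqVneq a 0.
  move: ra => /eqP; rewrite a0 mulf_eq0 (negPf pk0) /= => /eqP->.
  exact: rpred0.
have : N a%:~R <= (p%:R ^+ k)^-1.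
  rewrite -ra padic_normM // padic_normX padic_norm_prime exprVn.
  by rewrite ler_piMr // invr_ge0 exprn_ge0.
rewrite padic_normV_int // -exprnN.
rewrite lef_pV2 ?posrE ?exprn_gt0 ?ltr0n ?prime_gt0 //.
rewrite ler_eXn2l ?ltr1n ?prime_gt1 // => ka.
have /dvdnP[q aq] : (p ^ k %| `|a|)%N by rewrite pfactor_dvdn ?absz_gt0.
apply/intrP; exists (Num.sg a * q%:Z); apply: (mulfI pk0); rewrite ra.
by rewrite [in LHS](intEsg a) aq intrM PoszM !intrM -natrX; ring.
Qed.

(** Partial fractions. Write the denominator as b p^k with b prime to p; a Bezout relation u b + v
    p^k = 1 splits r into a term over p^k and a term over b. The latter is p-integral, and removing
    the floor of the former brings it into [0, 1[. *)
Lemma padic_frac_rat (r : rat) :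
  exists q, [/\ 0 <= q < 1, padic_denom q & N (r - q) <= 1].
Proof.
pose k := logn p `|denq r|; have d0 : denq r != 0 by rewrite denq_eq0.
have [b pb db] : exists2 b : nat, coprime p b & `|denq r|%N = (b * p ^ k)%N.
  have /(pfactor_coprime pP)[b pb db] : (0 < `|denq r|)%N by rewrite absz_gt0.
  by exists b.
have dE : (denq r)%:~R = (b%:R * p%:R ^+ k) :> rat.
  by rewrite -natrX -natrM -db -[RHS]/((`|denq r|%N : int)%:~R) absz_denq.
have b0 : (b%:R : rat) != 0.
  by apply: contraNneq d0 => b0; rewrite -(intr_eq0 rat) dE b0 mul0r.
have pk0 : (p%:R : rat) ^+ k != 0 by rewrite expf_neq0 // natr_prime_neq0.
have [u [v uv]] : exists u v : int, u * b + v * (p ^ k)%N = 1.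
  have /coprimezP[[u v] /= uv] : coprimez (b : int) (p ^ k)%N.
    by rewrite coprimezE /= coprimeXr // coprime_sym.
  by exists u, v.
have uvQ : u%:~R * b%:R + v%:~R * p%:R ^+ k = 1 :> rat.
  by move/(congr1 (fun m : int => m%:~R : rat)): uv; rewrite intrD !intrM -natrX.
pose q0 : rat := (numq r * u)%:~R / p%:R ^+ k.
have rq0 : r - q0 = (numq r * v)%:~R / b%:R.
  rewrite -[r in r - _]divq_num_den dE /q0 !intrM.
  move: (_ ^+ _) b%:R u%:~R v%:~R (numq r)%:~R pk0 b0 uvQ.
  move=> P B U V M P0 B0 uv1; apply: (mulfI (mulf_neq0 B0 P0)).
  rewrite [LHS](_ : _ = M * (1 - U * B)); last by field; rewrite P0 B0.
  by rewrite -uv1; field.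
exists (q0 - (Num.floor q0)%:~R); split.
- by have := floor_itv q0; rewrite intrD; lra.
- apply: padic_denomD.
    by exists k; rewrite mulrC divfK //; exact: intr_int.
  by apply: padic_denomN; exists 0%N; rewrite mul1r intr_int.
- have -> : r - (q0 - (Num.floor q0)%:~R) = (r - q0) + (Num.floor q0)%:~R by ring.
  apply: le_trans (padic_normD pP _ _) _; rewrite ge_max padic_norm_int_le1 andbT.
  rewrite rq0 padic_normM // padic_normV // -[b%:R]/((b : int)%:~R).
  by rewrite (padic_norm_coprime (b := b)) // invr1 mulr1 padic_norm_int_le1.
Qed.

Let const_cauchy (r : rat) : (fun=> r) \in padic_cauchy pP.
Proof.
by apply/asboolP => e e0; exists 0%N => i j _ _; rewrite subrr padic_norm0.
Qed.

Let pi_val (a b : cauchy_seq pP) : val a = val b -> \pi_Qp a = \pi_Qp b.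
Proof. by move=> /val_inj->. Qed.

(** Q_p is not an ordered field, so the compatibility of [ratr] with the operations is read off on
    constant Cauchy sequences. *)
Let pi_const (r : rat) : \pi_Qp (CauchySeq (const_cauchy r)) = ratr r.
Proof.
have natE m : \pi_Qp (CauchySeq (const_cauchy m%:R)) = m%:R.
  rewrite -(rmorph_nat (\pi_Qp)); apply: pi_val => /=.
  elim: m => [|m IH]; first by rewrite mulr0n.
  by rewrite [in RHS]mulrS /= -IH; apply/funext => i; rewrite /= mulrS.
have intE (m : int) : \pi_Qp (CauchySeq (const_cauchy m%:~R)) = m%:~R.
  case: m => m; first exact: natE.
  rewrite NegzE !rmorphN /= -[m.+1%:~R]/(m.+1%:R) -[X in _ = - X]/(m.+1%:R) -natE.
  by rewrite -[RHS]rmorphN; apply: pi_val.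
rewrite /ratr; have d0 : ((denq r)%:~R : Qp) != 0.
  rewrite -padic_abs_eq0 -[X in padic_abs X]ratr_int padic_abs_ratr.
  by rewrite padic_norm_eq0 // intr_eq0 denq_eq0.
apply: (mulIf d0); rewrite divfK // -!intE -rmorphM; apply: pi_val.
by apply/funext => i /=; rewrite numqE.
Qed.

(** A far enough term [a K] of a representing sequence works: its distance to x, if not 0, is the
    eventual value of |a_i - a_K|_p. *)
Lemma padic_rat_dense (x : Qp) (e : rat) : 0 < e ->
  exists r : rat, padic_abs (x - ratr r) < e.
Proof.
move=> e0; rewrite -[x]reprK; move: (repr x) => {x} a.
have /asboolP/(_ e e0)[K aK] := valP a.
exists (a K); rewrite -pi_const.
have -> : \pi_Qp a - \pi_Qp (CauchySeq (const_cauchy (a K))) =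
  \pi_Qp (a - CauchySeq (const_cauchy (a K))) by rewrite rmorphB.
have [->|] := eqVneq (\pi_Qp (a - CauchySeq (const_cauchy (a K)))) 0.
  by rewrite padic_abs0.
move=> /padic_abs_eventually[_ [L aL]].
rewrite -(aL (maxn K L)) ?leq_maxr //; apply: aK => //; exact: leq_maxl.
Qed.

Lemma padic_ratrD (r s : rat) : ratr (r + s) = ratr r + ratr s :> Qp.
Proof.
by rewrite -!pi_const -rmorphD; apply: pi_val.
Qed.

Lemma padic_ratrM (r s : rat) : ratr (r * s) = ratr r * ratr s :> Qp.
Proof.
by rewrite -!pi_const -rmorphM; apply: pi_val.
Qed.

Lemma padic_ratrN (r : rat) : ratr (- r) = - ratr r :> Qp.
Proof. by rewrite -!pi_const -rmorphN; apply: pi_val. Qed.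

(** A candidate always exists, so the default value of [xget] is never reached: x differs by an
    element of Z_p from a rational, whose fractional part also serves for x. *)
Lemma padic_fracP (x : Qp) : [/\ 0 <= padic_frac x < 1,
  padic_denom (padic_frac x) & padic_abs (x - ratr (padic_frac x)) <= 1].
Proof.
rewrite /padic_frac; case: xgetP => [r _ //|/(_ _) H].
have [r /ltW xr] := padic_rat_dense x ltr01.
have [q [q1 qd rq]] := padic_frac_rat r; case: (H q); split => //.
have -> : x - ratr q = (x - ratr r) + ratr (r - q).
  by rewrite padic_ratrD padic_ratrN; ring.
by apply: le_trans (padic_absD _ _) _; rewrite ge_max xr padic_abs_ratr.
Qed.

(** The difference lies both in Z[1/p] and in Z_p, hence in Z. This is what makes the characters
    multiplicative. *)
Lemma padic_fracD (x y : Qp) :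
  padic_frac (x + y) - (padic_frac x + padic_frac y) \is a Num.int.
Proof.
have [_ dx nx] := padic_fracP x; have [_ dy ny] := padic_fracP y.
have [_ dxy nxy] := padic_fracP (x + y).
apply: padic_denom_int.
  by apply: padic_denomD => //; apply: padic_denomN; exact: padic_denomD.
rewrite -(padic_abs_ratr pP) padic_ratrD padic_ratrN padic_ratrD.
move: nx ny nxy.
move: (ratr (padic_frac x)) (ratr (padic_frac y)) (ratr (padic_frac (x + y))).
move=> b c a nx ny nxy.
have -> : a - (b + c) = - (x + y - a) + ((x - b) + (y - c)) by ring.
apply: le_trans (padic_absD _ _) _; rewrite ge_max padic_absN nxy /=.
by apply: le_trans (padic_absD _ _) _; rewrite ge_max nx ny.
Qed.

(** Two candidates in [0, 1[ differ by an integer of absolute value less than 1. *)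
Lemma padic_frac_unique (x : Qp) r : 0 <= r < 1 -> padic_denom r ->
  padic_abs (x - ratr r) <= 1 -> padic_frac x = r.
Proof.
move=> r1 dr xr; have [f1 df nf] := padic_fracP x.
have /intrP[m Em] : padic_frac x - r \is a Num.int.
  apply: padic_denom_int; first by apply: padic_denomD => //; exact: padic_denomN.
  rewrite -(padic_abs_ratr pP) padic_ratrD padic_ratrN.
  move: nf xr; move: (ratr (padic_frac x)) (ratr r) => b c nf xr.
  have -> : b - c = - (x - b) + (x - c) by ring.
  by apply: le_trans (padic_absD _ _) _; rewrite ge_max padic_absN nf.
have : -1 < (m%:~R : rat) < 1 by rewrite -Em; lra.
rewrite -[-1]/((-1)%:~R) -[1]/(1%:~R) !ltr_int => m1.
have m0 : m = 0 by lia.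
by apply/eqP; rewrite -subr_eq0 Em m0.
Qed.

End PadicFractionalPart.

(** * Values of the p-adic absolute value, and finite covers of polydiscs *)

Section Polydisc.
Variables (p : nat) (pP : prime p) (n : nat).
Local Notation Qp := (padic pP).
Local Notation V := 'rV[Qp]_n.

Lemma padic_abs_exp (x : Qp) : x != 0 ->
  exists z : int, padic_abs x = p%:R ^ z.
Proof.
move=> x0; move: (x0); rewrite -{1}[x]reprK => /padic_abs_eventually[].
rewrite reprK => a0 [K /(_ K (leqnn K))] aK; move: a0; rewrite -aK /padic_norm.
by case: ifP => _; rewrite ?ltxx // => _; eexists.
Qed.

Lemma padic_abs_prime : padic_abs (p%:R : Qp) = p%:R^-1.
Proof. by rewrite -(ratr_nat Qp) padic_abs_ratr padic_norm_prime. Qed.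

Lemma padic_abs1 : padic_abs (1 : Qp) = 1.
Proof. by have := padic_abs_ratr pP 1%:R; rewrite ratr_nat padic_norm1. Qed.

Lemma padic_ratr0 : ratr 0 = 0 :> Qp.
Proof. exact: (ratr_nat Qp 0). Qed.

Lemma padic_absV (x : Qp) : padic_abs x^-1 = (padic_abs x)^-1.
Proof.
have [->|x0] := eqVneq x 0; first by rewrite !(invr0, padic_abs0).
apply: (mulfI (x := padic_abs x)); first by rewrite padic_abs_eq0.
by rewrite -padic_absM !mulfV ?padic_abs1 // padic_abs_eq0.
Qed.

Lemma padic_prime_neq0 : (p%:R : Qp) != 0.
Proof.
by rewrite -padic_abs_eq0 padic_abs_prime invr_eq0 natr_prime_neq0.
Qed.

Lemma padic_ratr_primeV : ratr p%:R^-1 = p%:R^-1 :> Qp.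
Proof.
apply: (mulIf padic_prime_neq0); rewrite mulVf ?padic_prime_neq0 //.
rewrite -[X in _ * X](ratr_nat Qp) -padic_ratrM mulVf ?natr_prime_neq0 //.
exact: (ratr_nat Qp 1).
Qed.

Lemma padic_abs_primeX (z : int) : padic_abs ((p%:R : Qp) ^ z) = p%:R ^ (- z).
Proof.
have natE m : padic_abs ((p%:R : Qp) ^+ m) = p%:R ^- m.
  elim: m => [|m IH]; first by rewrite !expr0 padic_abs1 invr1.
  by rewrite !exprS padic_absM IH padic_abs_prime invfM.
by case: z => m; rewrite ?NegzE -?exprnN ?opprK -?exprnP ?padic_absV natE ?invrK.
Qed.

Lemma prime_exprz_gt0 (z : int) : 0 < (p%:R : rat) ^ z.
Proof. by rewrite exprz_gt0 // ltr0n prime_gt0. Qed.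

(** The residue of x modulo p^m is p^m q, where q is the fractional part of x / p^m: it lies in
    Z[1/p] and in Z_p, hence is an integer, and 0 <= q < 1 bounds it. *)
Lemma padic_digits (x : Qp) m : padic_abs x <= 1 ->
  exists d : 'I_(p ^ m), padic_abs (x - d%:R) <= p%:R ^- m.
Proof.
move=> x1; pose q := padic_frac (p%:R ^- m * x).
have [/andP[q0 q1] qd nq] := padic_fracP (p%:R ^- m * x); rewrite -/q in q0 q1 qd nq.
have pm : 0 < (p%:R : rat) ^+ m by rewrite exprn_gt0 // ltr0n prime_gt0.
have P0 : (p%:R : Qp) ^+ m != 0 by rewrite expf_neq0 // padic_prime_neq0.
have absP : padic_abs ((p%:R : Qp) ^+ m) = p%:R ^- m.
  by have := padic_abs_primeX m; rewrite -exprnP => ->; rewrite -exprnN.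
have xq : padic_abs (x - ratr (p%:R ^+ m * q)) <= p%:R ^- m.
  rewrite padic_ratrM -natrX ratr_nat !natrX.
  rewrite -[x in x - _](mulKf (invr_neq0 P0)) invrK -mulrBr padic_absM absP.
  by rewrite ler_piMr // invr_ge0 ltW.
have /intrP[d dE] : p%:R ^+ m * q \is a Num.int.
  apply: (padic_denom_int pP).
    have [k kq] := qd; exists k; rewrite mulrCA rpredM //.
    by rewrite -natrX; exact: intr_nat.
  rewrite -(padic_abs_ratr pP); set y := ratr _.
  have -> : y = - (x - y) + x by ring.
  apply: le_trans (padic_absD _ _) _; rewrite ge_max padic_absN x1 andbT.
  apply: le_trans xq _; rewrite invf_le1 // exprn_ege1 // ler1n.
  exact: prime_gt0.
have d0 : 0 <= d by rewrite -(ler_int rat) -dE mulr_ge0 // ltW.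
have dm : (`|d| < p ^ m)%N.
  rewrite -ltz_nat gez0_abs // -(ltr_int rat) -dE -[ltRHS]/((p ^ m)%:R) natrX.
  by rewrite gtr_pMr.
exists (Ordinal dm); move: xq; rewrite dE -[in ratr _](gez0_abs d0).
by rewrite -[in ratr _]/(`|d|%N%:R) ratr_nat.
Qed.

(** For r = p^z this is the subgroup p^-z Z_p^n. *)
Definition polydisc (r : rat) : set V := [set x | forall j, padic_abs (x 0 j) <= r].

Lemma polydisc0 r : 0 <= r -> polydisc r 0.
Proof. by move=> r0 j; rewrite mxE padic_abs0. Qed.

Lemma polydiscD r x y : polydisc r x -> polydisc r y -> polydisc r (x + y).
Proof.
move=> xr yr j; rewrite mxE; apply: le_trans (padic_absD _ _) _.
by rewrite ge_max xr yr.
Qed.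

Lemma polydiscN r x : polydisc r x -> polydisc r (- x).
Proof. by move=> xr j; rewrite mxE padic_absN. Qed.

Lemma polydiscB r x y : polydisc r x -> polydisc r y -> polydisc r (x - y).
Proof. by move=> xr /polydiscN; exact: polydiscD. Qed.

Lemma polydisc_le r s x : r <= s -> polydisc r x -> polydisc s x.
Proof. by move=> rs xr j; exact: le_trans rs. Qed.

(** Multiplication by p^z reduces to Z_p^n; the centres are the vectors of residues modulo p^m,
    scaled back by p^-z. *)
Lemma polydisc_cover (z : int) (m : nat) : exists s : seq V,
  forall x, polydisc (p%:R ^ z) x ->
  exists2 a, a \in s & polydisc (p%:R ^ (z - m%:Z)) (x - a).
Proof.
pose c (f : {ffun 'I_n -> 'I_(p ^ m)}) : V := \row_j ((p%:R : Qp) ^ (- z) * (f j)%:R).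
have P0 := padic_prime_neq0.
exists (map c (enum {: {ffun 'I_n -> 'I_(p ^ m)}})) => x xz.
have H j : exists d : 'I_(p ^ m),
    padic_abs ((p%:R : Qp) ^ z * x 0 j - d%:R) <= p%:R ^- m.
  apply: padic_digits; rewrite padic_absM padic_abs_primeX -invr_expz.
  by rewrite mulrC ler_pdivrMr ?prime_exprz_gt0 // mul1r.
have [f fP] := choice H; exists (c (finfun f)).
  by apply: map_f; rewrite mem_enum.
move=> j; rewrite !mxE ffunE.
have -> : x 0 j - p%:R ^ (- z) * (f j)%:R =
    p%:R ^ (- z) * (p%:R ^ z * x 0 j - (f j)%:R).
  by rewrite mulrBr mulrA -expfzDr // addNr mul1r.
rewrite padic_absM padic_abs_primeX opprK expfzDr ?natr_prime_neq0 //.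
by rewrite ler_pM2l ?prime_exprz_gt0 // -exprnN.
Qed.

End Polydisc.

(** * Additive characters and the annihilator of a polydisc *)

Section Character.
Variables (R : realType) (p : nat) (pP : prime p) (n : nat).
Local Notation Qp := (padic pP).
Local Notation V := 'rV[Qp]_n.
Local Notation C := R[i].
Local Notation chi := (@padic_char R p pP n).

Let cis (t : R) : C := (cos t +i* sin t)%C.

Let cisD s t : cis (s + t) = cis s * cis t.
Proof.
apply/eqP; rewrite eq_complex /= cosD sinD; apply/andP; split => //.
by rewrite addrC.
Qed.

Let cis_int (m : int) : cis (2 * pi * m%:~R) = 1.
Proof.
have c1 : cis (2 * pi) = 1.
  have -> : 2 * pi = pi *+ 2 :> R by rewrite mulr_natl.
  by rewrite /cis cos2pi sin2pi.
have natE k : cis (2 * pi * k%:R) = 1.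
  elim: k => [|k IH]; first by rewrite mulr0 /cis cos0 sin0.
  by rewrite (mulrS _ k) mulrDr cisD mulr1 c1 IH mulr1.
case: m => k; first exact: natE.
have : cis (2 * pi * k.+1%:R) * cis (2 * pi * (Negz k)%:~R) = 1.
  by rewrite -cisD NegzE rmorphN /= mulrN subrr /cis cos0 sin0.
by rewrite natE mul1r.
Qed.

Lemma padic_charC (xi x : V) : chi xi x = chi x xi.
Proof. by rewrite /padic_char; under eq_bigr do rewrite mulrC. Qed.

(** The two sums of fractional parts differ by an integer, which exp(2 pi i t) does not see. *)
Lemma padic_charD (xi x y : V) : chi xi (x + y) = chi xi x * chi xi y.
Proof.
have /intrP[m mE] : (\sum_j padic_frac (xi 0 j * (x + y) 0 j) -
    (\sum_j padic_frac (xi 0 j * x 0 j) + \sum_j padic_frac (xi 0 j * y 0 j)))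
    \is a Num.int.
  rewrite -big_split -sumrB rpred_sum // => j _.
  by rewrite mxE mulrDr padic_fracD.
move/eqP: mE; rewrite subr_eq => /eqP mE.
have charE z : chi xi z = cis (2 * pi * ratr (\sum_j padic_frac (xi 0 j * z 0 j))).
  by [].
by rewrite !charE mE !rmorphD /= ratr_int mulrDr cisD cis_int mul1r mulrDr cisD.
Qed.

Lemma padic_char1 (xi x : V) : (forall j, padic_abs (xi 0 j * x 0 j) <= 1) ->
  chi xi x = 1.
Proof.
move=> H; rewrite /padic_char big1; first by rewrite rmorph0 mulr0 cos0 sin0.
move=> j _; apply: (padic_frac_unique (pP := pP)) => //.
  by exists 0%N; rewrite mulr0 rpred0.
by rewrite padic_ratr0 subr0.
Qed.

Lemma padic_char0 (xi : V) : chi xi 0 = 1.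
Proof. by apply: padic_char1 => j; rewrite mxE mulr0 padic_abs0. Qed.

(** With [padic_char_nontrivial], this identifies the polydisc of radius p^-z as the annihilator of
    the one of radius p^z. *)
Lemma padic_char_polydisc (z : int) (xi x : V) : polydisc (p%:R ^ (- z)) xi ->
  polydisc (p%:R ^ z) x -> chi xi x = 1.
Proof.
move=> xiz xz; apply: padic_char1 => j; rewrite padic_absM.
have -> : 1 = (p%:R : rat) ^ (- z) * p%:R ^ z.
  by rewrite -expfzDr ?natr_prime_neq0 // addNr.
by rewrite ler_pM ?padic_abs_ge0.
Qed.

(* If xi_j is too large, then x = (p xi_j)^-1 e_j has chi(xi . x) = exp(2 pi i / p). *)
Lemma padic_char_nontrivial (z : int) (xi : V) : ~ polydisc (p%:R ^ (- z)) xi ->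
  exists2 x, polydisc (p%:R ^ z) x & chi xi x != 1.
Proof.
move=> /existsNP[j /negP]; rewrite -ltNge => xij.
have p1 : 1 < (p%:R : rat) by rewrite ltr1n prime_gt1.
have xi0 : xi 0 j != 0.
  by rewrite -padic_abs_eq0 gt_eqF // (lt_trans _ xij) // prime_exprz_gt0.
exists (\row_k if k == j then (p%:R * xi 0 j)^-1 else 0) => /=.
  move=> k; rewrite mxE; case: eqP => _; last first.
    by rewrite padic_abs0 ltW // prime_exprz_gt0.
  (* Absolute values are powers of p, so |xi_j| = p^w > p^-z forces w >= 1 - z; this gain of one
     makes room for the extra factor p in the witness. *)
  have [w wE] := padic_abs_exp xi0; rewrite wE in xij.
  rewrite padic_absV padic_absM padic_abs_prime wE -(invrK (p%:R ^ z)).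
  rewrite lef_pV2 ?posrE ?invr_gt0 ?mulr_gt0 ?invr_gt0 ?prime_exprz_gt0 //; last first.
    by rewrite ltr0n prime_gt0.
  rewrite invr_expz -[p%:R^-1]/(p%:R ^ (-1)) -expfzDr ?natr_prime_neq0 //.
  by rewrite ler_eXz2l //; move: xij; rewrite ltr_eXz2l //; lia.
rewrite /padic_char (bigD1 j) //= big1 => [|k kj]; last first.
  rewrite mxE (negPf kj) mulr0; apply: (padic_frac_unique (pP := pP)) => //.
    by exists 0%N; rewrite mulr0 rpred0.
  by rewrite padic_ratr0 subr0 padic_abs0.
have -> : padic_frac (xi 0 j * (\row_k (if k == j then (p%:R * xi 0 j)^-1 else 0)) 0 j) = p%:R^-1.
  apply: (padic_frac_unique (pP := pP)).
  - by rewrite invr_ge0 ler0n invf_lt1 // ltr0n prime_gt0.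
  - by exists 1%N; rewrite expr1 mulfV ?natr_prime_neq0 // rpred1.
  - rewrite mxE eqxx padic_ratr_primeV invfM mulrCA mulfV // mulr1 subrr.
    by rewrite padic_abs0.
(* The real part cos(2 pi / p) already differs from 1: as p >= 2, the angle lies in ]0, pi], where
   cos is below cos 0. *)
rewrite addr0 eq_complex /= negb_and; apply/orP; left.
have -> : ratr p%:R^-1 = p%:R^-1 :> R by rewrite fmorphV /= ratr_nat.
have pR : 2 <= (p%:R : R) by rewrite (ler_nat _ 2) prime_gt1.
rewrite lt_eqF // -[ltRHS]cos0; have pi0 := pi_gt0 R.
have q0 : 0 < (p%:R : R)^-1 by rewrite invr_gt0; lra.
have q2 : (p%:R : R)^-1 <= 2^-1 by rewrite lef_pV2 // posrE; lra.
set v := _^-1 in q0 q2 *.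
have v0 : 0 < 2 * pi * v by rewrite !mulr_gt0.
have v1 : 2 * pi * v <= pi by nra.
by rewrite ltr_cos ?in_itv /= ?lexx ?(ltW v0) ?v1 ?(ltW pi0).
Qed.

End Character.

(** * Haar measure of cosets, complex integrals, and translation invariance *)

Section HaarIntegral.
Local Open Scope classical_set_scope.
Variables (R : realType) (p : nat) (pP : prime p) (n : nat).
Local Notation Qp := (padic pP).
Local Notation V := 'rV[Qp]_n.
Local Notation C := R[i].
Local Notation T := (padic_borel pP n).
Local Notation chi := (@padic_char R p pP n).
Variable mu : haar R pP n.

Definition padic_coset (a : V) (r : rat) : set V := [set x | polydisc r (x - a)].

Lemma padic_ballE (u v : Qp) e : ball u e v = (padic_abs (u - v) < e) :> Prop.
Proof. by rewrite ballEmdist. Qed.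

Lemma coset_nbhs (a : V) r : 0 < r -> nbhs a (padic_coset a r).
Proof.
move=> r0; apply: filterS (nbhsx_ballx a r r0) => y [_ ay] j.
by have := ay 0 j; rewrite padic_ballE !mxE padic_distC => /ltW.
Qed.

Lemma coset_trans (a b c : V) r : padic_coset a r b -> padic_coset b r c -> padic_coset a r c.
Proof.
rewrite /padic_coset /= => ab bc; have -> : c - a = (c - b) + (b - a) by rewrite addrA subrK.
exact: (polydiscD bc ab).
Qed.

Lemma coset_sym (a b : V) r : padic_coset a r b -> padic_coset b r a.
Proof. by rewrite /padic_coset /= => /polydiscN; rewrite opprB. Qed.

Lemma coset_open (a : V) r : 0 < r -> open (padic_coset a r).
Proof.
move=> r0; rewrite openE => x ax; apply: filterS (coset_nbhs x r0) => y.
exact: coset_trans.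
Qed.

Lemma coset_measurable (a : V) r : 0 < r -> measurable (padic_coset a r : set T).
Proof. by move=> r0; apply: open_measurable_borel; exact: coset_open. Qed.

Lemma mu_coset (a : V) r : 0 < r -> mu (padic_coset a r) = mu (@polydisc p pP n r).
Proof.
move=> r0; have -> : @polydisc p pP n r = padic_coset 0 r.
  by apply/seteqP; split => x; rewrite /padic_coset /= subr0.
rewrite -[RHS](haar_translate mu a (coset_measurable 0 r0)).
congr (mu _); apply/seteqP; split => x.
  by move=> ax; exists (x - a); [rewrite /padic_coset /= subr0|rewrite addrC subrK].
by move=> [y]; rewrite /padic_coset /= subr0 => yr <-; rewrite addrC addKr.
Qed.

(** After translation to 0, the polydisc is enlarged to radius p^|z|, which [polydisc_cover] with m
    = |z| covers by finitely many cosets of radius 1; each of these has measure 1. *)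
Lemma mu_coset_lty (a : V) (z : int) : (mu (padic_coset a (p%:R ^ z)) < +oo)%E.
Proof.
have [s sP] := @polydisc_cover p pP n `|z|%N `|z|.
rewrite mu_coset ?prime_exprz_gt0 //.
have sub : @polydisc p pP n (p%:R ^ z) `<=`
    [set x | exists2 a, a \in s & padic_coset a 1 x].
  move=> x xz; have [|b bs] := sP x.
    by apply: polydisc_le xz; rewrite ler_weXz2l ?ler1n ?prime_gt0 //; lia.
  by rewrite subrr expr0z; exists b.
have mz : measurable (@polydisc p pP n (p%:R ^ z) : set T).
  rewrite (_ : @polydisc p pP n (p%:R ^ z) = padic_coset 0 (p%:R ^ z)).
    by apply: coset_measurable; exact: prime_exprz_gt0.
  by apply/seteqP; split => x; rewrite /padic_coset /= subr0.
suff [U [mU sU Ufin]] : exists U : set V, [/\ measurable (U : set T),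
    [set x | exists2 a, a \in s & padic_coset a 1 x] `<=` U & (mu U < +oo)%E].
  apply: le_lt_trans Ufin; apply: le_measure; rewrite ?inE //.
  exact: subset_trans sub sU.
elim: s {sP sub} => [|b s [U [mU sU Ufin]]].
  by exists set0; split => [//|x []//|]; rewrite measure0.
have mb := coset_measurable b ltr01.
exists (padic_coset b 1 `|` U); split; first exact: measurableU.
  move=> x [c]; rewrite inE => /orP[/eqP->|cs] cx; first by left.
  by right; apply: sU; exists c.
apply: le_lt_trans (measureU2 _ mb mU) _.
have : (mu (padic_coset b 1) < +oo)%E by rewrite mu_coset // haar_integers ltry.
by move=> fb; exact: lte_add_pinfty fb Ufin.
Qed.

(** Local constancy makes preimages open, hence Borel; a bounded measurable function is integrable
    on a set of finite measure. *)
Lemma integrable_locally_constant_on_coset (g : V -> R) (a : V) (z : int) (M : R) :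
  locally_constant_on setT g -> (forall x, `|g x| <= M) ->
  mu.-integrable setT (EFin \o (g \_ (padic_coset a (p%:R ^ z)))).
Proof.
move=> gl gM; rewrite -restrict_EFin.
have mK := coset_measurable a (prime_exprz_gt0 pP z).
apply/(integrable_mkcond _ mK); apply: measurable_bounded_integrable => //.
- exact: mu_coset_lty.
- apply: measurable_funTS => _ Y mY; rewrite setTI.
  apply: open_measurable_borel; rewrite openE => x /= gY.
  rewrite /interior; near=> y.
  suff gyx : g y = g x by rewrite /= gyx.
  by near: y; exact: gl.
- by exists M; split; [exact: num_real|move=> N MN x _]; exact: le_trans (gM x) (ltW MN).
Unshelve. all: by end_near.
Qed.

Definition complex_integrable (h : V -> C) :=
  mu.-integrable setT (EFin \o (fun x => complex.Re (h x))) /\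
  mu.-integrable setT (EFin \o (fun x => complex.Im (h x))).

Lemma complex_integrable_linear (a : C) h k :
  complex_integrable h -> complex_integrable k ->
  complex_integrable (fun x => a * h x + k x) /\
  complex_integral mu (fun x => a * h x + k x) =
  a * complex_integral mu h + complex_integral mu k.
Proof.
move=> [hR hI] [kR kI]; case: a => ar ai.
(* The real and imaginary parts of a h + k are nested real combinations, so this real statement is
   used twice for a h, then twice with coefficients 1 to add k. *)
have E (u v : V -> R) (c d : R) :
    mu.-integrable setT (EFin \o u) -> mu.-integrable setT (EFin \o v) ->
    mu.-integrable setT (EFin \o (fun x => c * u x + d * v x)) /\
    \int[mu]_x (c * u x + d * v x) = c * (\int[mu]_x u x) + d * (\int[mu]_x v x).
  move=> iu iv; have iu' : mu.-integrable setT (EFin \o (fun x => c * u x)).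
    exact: (integrableZl measurableT c iu).
  have iv' : mu.-integrable setT (EFin \o (fun x => d * v x)).
    exact: (integrableZl measurableT d iv).
  split; first exact: (integrableD measurableT iu' iv').
  by rewrite RintegralD // !RintegralZl.
have [i1 E1] := E _ _ ar (- ai) hR hI.
have [i2 E2] := E _ _ ar ai hI hR.
have [i3 E3] := E _ _ 1 1 i1 kR.
have [i4 E4] := E _ _ 1 1 i2 kI.
rewrite /complex_integrable /complex_integral.
rewrite (_ : (fun x => complex.Re _) = (fun x =>
    1 * (ar * complex.Re (h x) + - ai * complex.Im (h x)) +
    1 * complex.Re (k x))); last first.
  by apply/funext => x; case: (h x) (k x) => [? ?] [? ?] /=; ring.
rewrite (_ : (fun x => complex.Im _) = (fun x =>
    1 * (ar * complex.Im (h x) + ai * complex.Re (h x)) +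
    1 * complex.Im (k x))); last first.
  by apply/funext => x; case: (h x) (k x) => [? ?] [? ?] /=; ring.
split; first by [].
rewrite E3 E4 E1 E2 /=; apply/eqP; rewrite eq_complex /=.
by apply/andP; split; apply/eqP; ring.
Qed.

Lemma complex_integrable0 : complex_integrable (fun=> 0).
Proof. by split; exact: integrable0. Qed.

Lemma complex_integral0 : complex_integral mu (fun=> 0) = 0.
Proof. by rewrite /complex_integral !Rintegral_cst // !mul0r. Qed.

Lemma complex_integralZ (a : C) h : complex_integrable h ->
  complex_integral mu (fun x => a * h x) = a * complex_integral mu h.
Proof.
move=> hi; have [_] := complex_integrable_linear a hi complex_integrable0.
by rewrite complex_integral0 addr0; under eq_fun do rewrite addr0.
Qed.

Lemma complex_integral_sum (I : Type) (s : seq I) (c : I -> C) (h : I -> V -> C) :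
  (forall i, complex_integrable (h i)) ->
  complex_integral mu (fun x => \sum_(i <- s) c i * h i x) =
  \sum_(i <- s) c i * complex_integral mu (h i).
Proof.
move=> hi.
suff [] : complex_integrable (fun x => \sum_(i <- s) c i * h i x) /\
    complex_integral mu (fun x => \sum_(i <- s) c i * h i x) =
    \sum_(i <- s) c i * complex_integral mu (h i) by [].
elim: s => [|i s [IH1 IH2]].
  under eq_fun do rewrite big_nil.
  by rewrite big_nil complex_integral0; split => //; exact: complex_integrable0.
under eq_fun do rewrite big_cons.
by rewrite big_cons -IH2; exact: complex_integrable_linear.
Qed.

(** Translations preserve balls, so they pull open sets back to open sets, and these generate the
    Borel sets. *)
Lemma measurable_translation (a : V) :
  measurable_fun setT ((fun x : V => x + a) : T -> T).
Proof.
apply: (@measurability _ _ T T setT _ (@open V)); first by [].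
move=> _ [U oU <-]; rewrite setTI.
apply: (@open_measurable_borel p pP n [set x : V | U (x + a)]).
rewrite openE => x /= Uxa.
have /nbhs_ballP[e /= e0 eU] : nbhs (x + a) U.
  by move: oU; rewrite openE => /(_ _ Uxa).
rewrite /interior; apply: filterS (nbhsx_ballx x e e0) => y [_ xy]; apply: eU.
split => // i j; have := xy i j; rewrite !padic_ballE !mxE.
by rewrite opprD addrACA subrr addr0.
Qed.

Lemma Rintegral_translation (g : V -> R) (a : V) :
  mu.-integrable setT (EFin \o g) ->
  mu.-integrable setT (EFin \o (fun x => g (x + a))) ->
  \int[mu]_x g (x + a) = \int[mu]_x g x.
Proof.
move=> gi gai; rewrite /Rintegral; congr fine.
pose ma := measurable_translation a.
have := @integral_pushforward _ _ _ _ _ _ ma mu setT (EFin \o g)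
  (measurable_int _ gi) gai measurableT.
rewrite preimage_setT /= => <-.
(* It remains to see that the image of [mu] under the translation by a is [mu]: the preimage of A is
   its translate by -a. *)
apply: (@eq_measure_integral _ _ _ setT mu) => A mA _ /=.
rewrite /pushforward -(haar_translate mu (- a) mA); congr (mu _).
apply/seteqP; split => x /=.
  by move=> Ax; exists (x + a) => //; rewrite addrC addrK.
by move=> [y Ay <-]; rewrite addrC addrA subrr add0r.
Qed.

Lemma complex_integral_translation (h : V -> C) (a : V) :
  complex_integrable h -> complex_integrable (fun x => h (x + a)) ->
  complex_integral mu (fun x => h (x + a)) = complex_integral mu h.
Proof.
move=> [hR hI] [haR haI]; rewrite /complex_integral.
by rewrite (Rintegral_translation hR haR) (Rintegral_translation hI haI).
Qed.

End HaarIntegral.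

(** * Fourier inversion for test functions, by way of step functions *)

Section FourierInversion.
Local Open Scope classical_set_scope.
Variables (R : realType) (p : nat) (pP : prime p) (n : nat).
Local Notation Qp := (padic pP).
Local Notation V := 'rV[Qp]_n.
Local Notation C := R[i].
Local Notation chi := (@padic_char R p pP n).
Variable mu : haar R pP n.

Definition coset_indic (a : V) (z : int) (x : V) : C :=
  (x \in padic_coset a (p%:R ^ z))%:R.

(** The Haar measure of p^-z Z_p^n as a complex number. Its value p^(z n) is never computed: its
    value at 0 and the relation [coset_volume_dual] suffice. *)
Definition coset_volume (z : int) : C := complex_integral mu (coset_indic 0 z).

Lemma complex_integrable_char (xi a : V) (z : int) :
  complex_integrable mu (fun x => chi xi x * coset_indic a z x).
Proof.
have chiE (l : C -> R) : (l = @complex.Re R \/ l = @complex.Im R) ->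
    (fun x => l (chi xi x * coset_indic a z x)) =
    (fun x => l (chi xi x)) \_ (padic_coset a (p%:R ^ z)).
  move=> lE; apply/funext => x; rewrite /patch /coset_indic.
  by case: ifP => _; rewrite ?mulr1 // mulr0; case: lE => ->.
split; rewrite chiE; [|by left| |by right];
  apply: (@integrable_locally_constant_on_coset _ _ _ _ mu _ a z 1).
- by move=> x _; apply: filterS (padic_char_locally_constant R xi I) => y ->.
- by move=> x; rewrite ler_norml cos_geN1 cos_le1.
- by move=> x _; apply: filterS (padic_char_locally_constant R xi I) => y ->.
- by move=> x; rewrite ler_norml sin_geN1 sin_le1.
Qed.

Lemma coset_indic_eq (a b x y : V) (z w : int) :
  (padic_coset a (p%:R ^ z) x <-> padic_coset b (p%:R ^ w) y) ->
  coset_indic a z x = coset_indic b w y.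
Proof.
move=> H; rewrite /coset_indic.
have -> : (x \in padic_coset a (p%:R ^ z)) = (y \in padic_coset b (p%:R ^ w)) by
  apply/idP/idP; rewrite !inE => /H.
by [].
Qed.

Lemma coset_indicT (a x : V) z : padic_coset a (p%:R ^ z) x -> coset_indic a z x = 1.
Proof. by move=> ax; rewrite /coset_indic mem_set. Qed.

Lemma coset_indicF (a x : V) z : ~ padic_coset a (p%:R ^ z) x -> coset_indic a z x = 0.
Proof. by move=> ax; rewrite /coset_indic memNset. Qed.

Lemma coset0E r (x : V) : padic_coset 0 r x = polydisc r x.
Proof. by rewrite /padic_coset /= subr0. Qed.

Lemma coset_indic_translate (a x y : V) z :
  coset_indic a z (x + y) = coset_indic (a - y) z x.
Proof.
by apply: coset_indic_eq; rewrite /padic_coset /= opprB addrA.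
Qed.

Lemma coset_volume0 : coset_volume 0 = 1.
Proof.
rewrite /coset_volume /complex_integral.
have cE : (fun x : V => complex.Re (coset_indic 0 0 x)) = \1_(padic_coset 0 1).
  by apply/funext => x; rewrite indicE /coset_indic expr0z; case: (_ \in _).
have sE : (fun x : V => complex.Im (coset_indic 0 0 x)) = fun=> 0.
  by apply/funext => x; rewrite /coset_indic; case: (_ \in _).
rewrite cE sE Rintegral_cst // mul0r /Rintegral integral_indic //; last first.
  exact: coset_measurable.
by rewrite setIT mu_coset // haar_integers.
Qed.

(** Translating by a reduces to the subgroup p^-z Z_p^n. There the character is either trivial, and
    the integral is the volume, or takes a value other than 1, and the integral vanishes. *)
Lemma complex_integral_char (xi a : V) (z : int) :
  complex_integral mu (fun x => chi xi x * coset_indic a z x) =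
  chi xi a * coset_volume z * coset_indic 0 (- z) xi.
Proof.
have translate (b y : V) :
    complex_integral mu (fun x => chi xi x * coset_indic b z x) =
    chi xi y * complex_integral mu (fun x => chi xi x * coset_indic (b - y) z x).
  have E : (fun x => chi xi (x + y) * coset_indic b z (x + y)) =
      fun x => chi xi y * (chi xi x * coset_indic (b - y) z x).
    apply/funext => x; rewrite coset_indic_translate padic_charD mulrA.
    by rewrite (mulrC (chi xi y)).
  rewrite -complex_integralZ; last exact: complex_integrable_char.
  rewrite -E; apply/esym; apply: complex_integral_translation.
    exact: complex_integrable_char.
  rewrite E; have := (complex_integrable_linear (chi xi y)
    (complex_integrable_char xi (b - y) z) (complex_integrable0 mu)).1.
  by under eq_fun do rewrite addr0.
rewrite (translate a a) subrr -mulrA; congr (_ * _).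
have [xiz|xiz] := pselect (polydisc (p%:R ^ (- z)) xi).
  rewrite [X in _ = _ * X]coset_indicT ?coset0E // mulr1.
  rewrite /coset_volume; congr complex_integral; apply/funext => x.
  have [xz|xz] := pselect (padic_coset 0 (p%:R ^ z) x); last first.
    by rewrite coset_indicF // mulr0.
  by rewrite coset0E in xz; rewrite (padic_char_polydisc _ xiz xz) mul1r.
rewrite [X in _ = _ * X]coset_indicF ?coset0E // mulr0.
have [y yz chiy] := padic_char_nontrivial R xiz.
(* As y lies in the subgroup, translating by it gives I = chi(y) I for the integral I, and chi(y) !=
   1 forces I = 0. *)
have := translate 0 y.
have -> : coset_indic (0 - y) z = coset_indic 0 z.
  apply/funext => x; rewrite -coset_indic_translate; apply: coset_indic_eq.
  rewrite !coset0E; split=> [xy|xz]; last exact: (polydiscD xz yz).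
  by rewrite -(addrK y x); exact: (polydiscB xy yz).
move=> /eqP; rewrite -subr_eq0 -[X in X - _]mul1r -mulrBl mulf_eq0 subr_eq0.
by rewrite eq_sym (negPf chiy) => /eqP.
Qed.

Lemma fourier_coset_indic (a : V) z : fourier mu (coset_indic a z) =
  fun xi => coset_volume z * (chi a xi * coset_indic 0 (- z) xi).
Proof.
apply/funext => xi; rewrite /fourier complex_integral_char padic_charC.
by rewrite mulrCA mulrA.
Qed.

(** The character chi_a left by the first transform merges with chi_y into chi_(y+a). The second
    transform thus tests whether y + a lies in the subgroup, that is, whether -y lies in the coset
    of a. *)
Lemma fourier_fourier_coset_indic (a y : V) z :
  fourier mu (fourier mu (coset_indic a z)) y =
  coset_volume z * coset_volume (- z) * coset_indic a z (- y).
Proof.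
rewrite fourier_coset_indic /fourier.
have -> : (fun xi => chi y xi * (coset_volume z * (chi a xi * coset_indic 0 (- z) xi)))
    = fun xi => coset_volume z * (chi (y + a) xi * coset_indic 0 (- z) xi).
  apply/funext => xi; rewrite padic_charC (padic_charC R a) (padic_charC R (y + a)).
  by rewrite padic_charD; ring.
rewrite complex_integralZ; last exact: complex_integrable_char.
rewrite complex_integral_char padic_char0 mul1r (opprK z) (mulrA (coset_volume z)).
have -> : coset_indic 0 z (y + a) = coset_indic a z (- y); last by [].
apply: coset_indic_eq; rewrite coset0E /padic_coset /=.
split=> /polydiscN; first by rewrite opprD.
by rewrite opprB opprK addrC.
Qed.

Lemma complex_integrable_fourier_coset_indic (a y : V) z :
  complex_integrable mu (fun xi => chi y xi * fourier mu (coset_indic a z) xi).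
Proof.
rewrite fourier_coset_indic.
have := (complex_integrable_linear (coset_volume z)
    (complex_integrable_char (y + a) 0 (- z)) (complex_integrable0 mu)).1.
congr complex_integrable; apply/funext => xi.
rewrite addr0 padic_charC padic_charD !(padic_charC R xi).
ring.
Qed.

(** Step functions of level z are encoded by lists of pairs (coefficient, centre). *)
Lemma fourier_step (s : seq (C * V)) z :
  fourier mu (fun x => \sum_(i <- s) i.1 * coset_indic i.2 z x) =
  fun xi => \sum_(i <- s) i.1 * fourier mu (coset_indic i.2 z) xi.
Proof.
apply/funext => xi; rewrite {1}/fourier.
under eq_fun do (rewrite mulr_sumr; under eq_bigr do rewrite mulrCA).
by apply: complex_integral_sum => i; exact: complex_integrable_char.
Qed.

(** The constant in [fourier_fourier_coset_indic] depends on the level but not on the centre, so it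
    factors out of sums at a common level. *)
Lemma fourier_fourier_step (s : seq (C * V)) z y :
  let f x := \sum_(i <- s) i.1 * coset_indic i.2 z x in
  fourier mu (fourier mu f) y = coset_volume z * coset_volume (- z) * f (- y).
Proof.
move=> f; rewrite /f fourier_step {1}/fourier.
under eq_fun do (rewrite mulr_sumr; under eq_bigr do rewrite mulrCA).
rewrite complex_integral_sum => [|i]; last first.
  exact: complex_integrable_fourier_coset_indic.
rewrite mulr_sumr; apply: eq_bigr => i _.
by rewrite [complex_integral _ _]fourier_fourier_coset_indic mulrCA.
Qed.

Lemma step_decomposition (z : int) (s : seq V) (f : V -> C) :
  (forall x y, padic_coset x (p%:R ^ z) y -> f y = f x) ->
  (forall x, f x != 0 -> exists2 a, a \in s & padic_coset a (p%:R ^ z) x) ->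
  exists t : seq (C * V), f = fun x => \sum_(i <- t) i.1 * coset_indic i.2 z x.
Proof.
elim: s f => [|a s IH] f finv fs.
  exists [::]; apply/funext => x; rewrite big_nil; apply/eqP/negPn/negP.
  by move=> /fs[].
(* The list may meet the same coset several times; setting f to 0 on the coset of a before recursing
   prevents double counting. *)
have [||t tE] := IH (fun x => if x \in padic_coset a (p%:R ^ z) then 0 else f x).
- move=> x y xy.
  have -> : (y \in padic_coset a (p%:R ^ z)) = (x \in padic_coset a (p%:R ^ z)).
    apply/idP/idP; rewrite !inE => H; last exact: coset_trans xy.
    exact: (coset_trans H (coset_sym xy)).
  by case: ifP => // _; exact: finv.
- move=> x; case: ifPn => [|xa]; first by rewrite eqxx.
  move=> /fs[b]; rewrite inE => /orP[/eqP-> xb|bs xb]; last by exists b.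
  by move: xa; rewrite mem_set.
exists ((f a, a) :: t); apply/funext => x; rewrite big_cons /=.
rewrite -[X in _ + X](congr1 (fun g => g x) tE) /coset_indic.
case: ifPn => [xa|_]; last by rewrite mulr0 add0r.
by rewrite mulr1 addr0; apply: finv; rewrite inE in xa.
Qed.

(* Counting cosets of p^k Z_p^n is avoided: apply the previous formula to the
   indicator of Z_p^n, seen as a step function at level 0 and at level k. *)
Lemma coset_volume_dual (k : nat) :
  coset_volume (- k%:Z) * coset_volume k = 1.
Proof.
have [s sP] := @polydisc_cover p pP n 0 k.
have k1 : (p%:R : rat) ^ (- k%:Z) <= 1.
  by rewrite -(expr0z p%:R) ler_weXz2l ?ler1n ?prime_gt0 //; lia.
have [||t tE] := @step_decomposition (- k%:Z) s (coset_indic 0 0).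
- move=> x y xy; apply: coset_indic_eq; rewrite expr0z.
  have xy1 : padic_coset x 1 y by exact: (polydisc_le k1 xy).
  split=> H; first exact: (coset_trans H (coset_sym xy1)).
  exact: (coset_trans H xy1).
- move=> x; have [|x0] := pselect (padic_coset 0 (p%:R ^ 0%Z) x); last first.
    by rewrite coset_indicF ?eqxx.
  by rewrite coset0E => /sP[a sa xa] _; exists a => //; rewrite sub0r in xa.
have tE0 : \sum_(i <- t) i.1 * coset_indic i.2 (- k%:Z) (- 0) = 1.
  transitivity (coset_indic 0 0 (- 0)); first by rewrite [in RHS]tE.
  by rewrite coset_indicT // coset0E oppr0; apply: polydisc0; rewrite expr0z.
have := congr1 (fun g => fourier mu (fourier mu g) 0) tE.
rewrite /= fourier_fourier_step fourier_fourier_coset_indic tE0.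
rewrite coset_indicT ?coset0E ?oppr0; last by apply: polydisc0; rewrite expr0z.
by rewrite coset_volume0 !mulr1 opprK.
Qed.

Lemma small_radius (e : rat) : 0 < e -> exists k : nat, (p%:R : rat) ^ (- k%:Z) < e.
Proof.
move=> e0; exists (Num.bound e^-1); rewrite -exprnN.
rewrite -[ltRHS]invrK ltf_pV2 ?posrE ?invr_gt0 ?exprn_gt0 ?ltr0n ?prime_gt0 //.
have e1 : 0 <= e^-1 by rewrite invr_ge0 ltW.
apply: lt_trans (archi_boundP e1) _.
by rewrite -natrX ltr_nat ltn_expl // prime_gt1.
Qed.

(** Compactness of the support is used twice: first to turn the local radii of constancy into a
    common level k, then to cover the support by finitely many cosets of that level. *)
Lemma test_is_step (f : V -> C) : is_test f -> exists (k : nat) (s : seq V),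
  (forall x y, padic_coset x (p%:R ^ (- k%:Z)) y -> f y = f x) /\
  (forall x, f x != 0 -> exists2 a, a \in s & padic_coset a (p%:R ^ (- k%:Z)) x).
Proof.
move=> [fl]; rewrite compact_cover; set K := closure _ => fK.
have KP x : f x != 0 -> K x by move=> fx; apply: subset_closure.
have H (x : V) : exists k : nat, forall y, padic_coset x (p%:R ^ (- k%:Z)) y -> f y = f x.
  have /nbhs_ballP[e /= e0 ef] := fl x I.
  have [k ke] := small_radius e0; exists k => y xy; apply: ef.
  split => // i j; rewrite padic_ballE padic_distC (ord1 i).
  by have := xy j; rewrite !mxE => H; exact: le_lt_trans H ke.
have [r rP] := choice H.
have cover0 (k : V -> nat) : K `<=` cover setT (fun x => padic_coset x (p%:R ^ (- (k x)%:Z))).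
  move=> x _; exists x => //; rewrite /padic_coset /= subrr.
  by apply: polydisc0; exact/ltW/prime_exprz_gt0.
have open0 (k : V -> nat) (x : V) : setT x -> open (padic_coset x (p%:R ^ (- (k x)%:Z))).
  by move=> _; apply: coset_open; exact: prime_exprz_gt0.
have [D _ KD] := fK _ _ _ (open0 r) (cover0 r).
pose k := \max_(x <- finmap.enum_fset D) r x.
have [E _ KE] := fK _ _ _ (open0 (fun=> k)) (cover0 (fun=> k)).
exists k, (finmap.enum_fset E); split; last first.
  by move=> x /KP/KE[a aE ax]; exists a.
(* By the ultrametric inequality, x and y both lie in the coset of the same centre a, on which f is
   constant. *)
have inv x y : K x -> padic_coset x (p%:R ^ (- k%:Z)) y -> f y = f x.
  move=> /KD[a /= aD ax] xy; rewrite (rP _ _ ax); apply: rP.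
  apply: coset_trans ax _; apply: polydisc_le xy.
  rewrite ler_weXz2l ?ler1n ?prime_gt0 // lerN2 lez_nat.
  exact: leq_bigmax_seq.
(* [inv] needs its base point in the support: take x or y, whichever has a nonzero value; if neither
   has, both values are 0. *)
move=> x y xy; have [fx|/KP Kx] := eqVneq (f x) 0; last exact: inv.
have [fy|/KP Ky] := eqVneq (f y) 0; first by rewrite fx fy.
by rewrite (inv _ _ Ky (coset_sym xy)).
Qed.

Lemma fourier_inversion (f : V -> C) : is_test f ->
  fourier mu (fourier mu f) = fun x => f (- x).
Proof.
move=> /test_is_step[k [s [finv fs]]].
have [t ->] := step_decomposition finv fs; apply/funext => y.
by rewrite fourier_fourier_step opprK coset_volume_dual mul1r.
Qed.

End FourierInversion.

(** * The Fourier transform on Psi, Phi and their duals *)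

Lemma linear_ext (K : nzRingType) (U W : lmodType K) (f g : {linear U -> W}) :
  f =1 g -> f = g.
Proof.
case: f g => f fc [g gc] /= /funext fg; subst g; congr GRing.Linear.Pack.
case: fc gc => [[fa] [fs]] [[ga] [gs]] /=.
by rewrite (Prop_irrelevance fa ga) (Prop_irrelevance fs gs).
Qed.

Section DualFourier.
Variables (R : realType) (p : nat) (pP : prime p) (n : nat).
Local Notation V := 'rV[padic pP]_n.
Local Notation C := R[i].
Local Notation lizorkin1 := (lizorkin1 R pP n).
Variable mu : haar R pP n.
Implicit Types (psi : lizorkin1) (phi : lizorkin2 mu) (A : symbol R pP n).

Lemma fourier_fourier1 psi :
  fourier mu (fourier1 mu psi) = fun x => psi (- x).
Proof. by apply: fourier_inversion; have /asboolP[] := valP psi. Qed.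

(** A second transform gives back psi up to reflection. *)
Lemma fourier1_inj : injective (fourier1 mu).
Proof.
move=> psi1 psi2 E; apply: val_inj; apply/funext => x.
have := congr1 (fun phi => fourier mu phi (- x)) E.
by rewrite !fourier_fourier1 opprK.
Qed.

Lemma fourier1_surj phi : exists psi, fourier1 mu psi = phi.
Proof.
have /asboolP[psi psiP phiE] := valP phi.
by exists (Lizorkin1 psiP); apply: val_inj.
Qed.

Lemma fourier2_inj : injective (fun phi => fourier mu phi).
Proof.
move=> phi1 phi2; have [psi1 <-] := fourier1_surj phi1.
have [psi2 <-] := fourier1_surj phi2; rewrite !fourier_fourier1 => E.
congr fourier1; apply: val_inj; apply/funext => x.
by have := congr1 (fun f => f (- x)) E; rewrite opprK.
Qed.

(** The inverse of F : Psi -> Phi; composing functionals with it inverts F : Phi' -> Psi'. *)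
Definition fourier1_preimage phi : lizorkin1 :=
  xget 0 [set psi | fourier1 mu psi = phi]%classic.

Lemma fourier1_preimageK phi : fourier1 mu (fourier1_preimage phi) = phi.
Proof. exact: (xgetPex 0 (fourier1_surj phi)). Qed.

Lemma fourier1_preimage_linear : linear fourier1_preimage.
Proof.
move=> a f g; apply: fourier1_inj; rewrite fourier1_linear.
by rewrite !fourier1_preimageK.
Qed.
HB.instance Definition _ := GRing.isLinear.Build C (lizorkin2 mu) lizorkin1 _
  fourier1_preimage fourier1_preimage_linear.

Lemma dual_fourier_inj : injective (@dual_fourier R p pP n mu).
Proof.
move=> f g E; apply: linear_ext => phi; have [psi <-] := fourier1_surj phi.
exact: (congr1 (fun u : dual1 R pP n => u psi) E).
Qed.

(** The functional u composed with [fourier1_preimage] is a preimage of u, so the default value of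
    [get] is never reached. *)
Lemma dual_fourier_invK (u : dual1 R pP n) :
  dual_fourier (dual_fourier_inv mu u) = u.
Proof.
rewrite /dual_fourier_inv; case: xgetP => [f _ //|H].
case: (H (u \o fourier1_preimage : dual2 mu)); apply: linear_ext => psi /=.
by congr (u _); apply: fourier1_inj; exact: fourier1_preimageK.
Qed.

(** Since F[F[psi]] is psi reflected, multiplying it by the reflected symbol in A^T gives the
    reflection of A psi, which is F[F[A psi]]; injectivity of F on Phi removes the outer F. *)
Lemma pdo_transpose_fourier1 A psi :
  pdo_transpose A (fourier1 mu psi) = fourier1 mu (mul_symbol1 A psi).
Proof.
apply: fourier2_inj; rewrite /pdo_transpose /fourier_inv fourier_fourier1.
have E : mul_symbol (fun xi => A (- xi)) (fun x => psi (- x)) =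
    fourier mu (fourier1 mu (mul_symbol1 A psi)).
  rewrite fourier_fourier1; apply/funext => x.
  by rewrite /= /mul_symbol oppr_eq0.
rewrite E; case: xgetP => [phi _ //|H].
by case: (H (fourier1 mu (mul_symbol1 A psi))).
Qed.

Lemma pdo_fourier1 A (f : dual2 mu) psi :
  pdo A f (fourier1 mu psi) = dual_mul A (dual_fourier f) psi.
Proof. by rewrite /pdo pdo_transpose_fourier1. Qed.

(** Away from 0 the factors cancel; at 0 the products are 0 by convention, and so is psi. *)
Lemma dual_mul_inv A (u : dual1 R pP n) : (forall xi, xi != 0 -> A xi != 0) ->
  dual_mul A (dual_mul (symbol_inv A) u) = u /\
  dual_mul (symbol_inv A) (dual_mul A u) = u.
Proof.
move=> A0; split; apply: linear_ext => psi /=; congr (u _); apply: val_inj;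
  apply/funext => x /=; rewrite /mul_symbol; case: eqVneq => [->|/A0 Ax];
  rewrite ?mulKf ?mulVKf //; by have /asboolP[_ ->] := valP psi.
Qed.

End DualFourier.

(** * Existence, uniqueness and form of the solution of A f = g *)

Theorem theorem5p1 (R : realType) (p : nat) (pP : prime p)
    (n : nat) (n_ge1 : (1 <= n)%N) (mu : haar R pP n) (A : symbol R pP n)
    (A_neq0 : forall xi : 'rV[padic pP]_n, xi != 0 -> A xi != 0)
    (g : dual2 mu) :
  let f := dual_fourier_inv mu (dual_mul (symbol_inv A) (dual_fourier g)) in
  [/\ pdo A f =1 g,
      (forall h : dual2 mu, pdo A h =1 g -> h = f)
    & f =1 pdo (symbol_inv A) g].
Proof.
move=> f; have Ff : dual_fourier f = dual_mul (symbol_inv A) (dual_fourier g).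
  exact: dual_fourier_invK.
split=> [phi|h hg|phi].
(* Every element of Phi is some F[psi], so the equation may be tested in Psi', where it is a
   multiplication. *)
- have [psi <-] := fourier1_surj phi.
  by rewrite pdo_fourier1 Ff (dual_mul_inv _ A_neq0).1.
(* F is injective on Phi', and F[h] is recovered from A F[h] = F[g] through multiplication by
   1/A. *)
- apply: dual_fourier_inj; rewrite Ff -[LHS](dual_mul_inv _ A_neq0).2.
  congr dual_mul; apply: linear_ext => psi.
  by rewrite -pdo_fourier1 hg.
- have [psi <-] := fourier1_surj phi.
  by rewrite pdo_fourier1 -Ff.
Qed.
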